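(* Fix $0<\varepsilon\ll1$ and let $\mathcal C=\mathcal C_\varepsilon$ be the cut-off collision operator. Then for every $m>4$ the operator $\mathcal C$ is bounded on $L^\infty_m$ in the sense that \[ \sup_{\sigma=\pm1}\sup_{k\in\mathbb R^2}\langle k\rangle^{m}\,|\mathcal C(n)(\sigma,k)|\;\le\; C_{\varepsilon,m}\,\|n\|_{L^\infty_m}^{2}\qquad\text{for all } n\in L^\infty_m , \] with a constant $C_{\varepsilon,m}$ independent of $n$. In particular, for all $m>4$, $\mathcal C$ maps $L^\infty_m$ into the space of (real-valued) functions with finite $L^\infty_m$-norm.
   Context: Modes and notation. A mode is $\alpha=(\sigma_\alpha,k_\alpha)$ with $\sigma_\alpha\in\{\pm1\}$ and $k_\alpha=(k_\alpha^1,k_\alpha^2)\in\mathbb R^2$ (superscripts are components); for $k_\alpha\ne0$ write $k_\alpha=|k_\alpha|(\cos\theta_\alpha,\sin\theta_\alpha)$; same conventions for $\beta,\gamma$. Put $\langle k\rangle=(1+|k|^2)^{1/2}$. The dispersion relation is $\omega_\alpha=\sigma_\alpha k_\alpha^1/|k_\alpha|=\sigma_\alpha\cos\theta_\alpha$. The interaction coefficient is \[ \Gamma_{\alpha\beta\gamma}=\pi^2(\sigma_\alpha\sin\theta_\alpha+\sigma_\beta\sin\theta_\beta+\sigma_\gamma\sin\theta_\gamma)(\sigma_\alpha|k_\alpha|+\sigma_\beta|k_\beta|+\sigma_\gamma|k_\gamma|). \] Cut-off. $0<\varepsilon\ll1$ means that $\varepsilon$ is a fixed sufficiently small number. $\chi_\varepsilon$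 is a fixed smooth $2\pi$-periodic function with $0\le\chi_\varepsilon\le1$, depending only on $|\cos\theta|$, with $\chi_\varepsilon(\theta)=0$ if $|\cos\theta|<\varepsilon$ or $\big||\cos\theta|-\tfrac12\big|<\varepsilon$, and $\chi_\varepsilon(\theta)=1$ if $|\cos\theta|>2\varepsilon$ and $\big||\cos\theta|-\tfrac12\big|>2\varepsilon$. Collision operator. Formally, with $\int d\beta=\sum_{\sigma_\beta=\pm1}\int_{\mathbb R^2}dk_\beta$, \[ \mathcal C_\varepsilon(n)(\alpha)=\int\Gamma_{\alpha\beta\gamma}^2\,\omega_\alpha\,\chi_\varepsilon(\theta_\alpha)\chi_\varepsilon(\theta_\beta)\chi_\varepsilon(\theta_\gamma)\big(\omega_\alpha n_\beta n_\gamma+\omega_\gamma n_\alpha n_\beta+\omega_\beta n_\alpha n_\gamma\big)\,\delta(k_\alpha+k_\beta+k_\gamma)\,\delta(\omega_\alpha+\omega_\beta+\omega_\gamma)\,d\beta\,d\gamma . \] The delta functions are interpreted by the co-area formula: for $k_\alpha\ne0$, $\int F\,\delta(k_\alpha+k_\beta+k_\gamma)\delta(\omega_\alpha+\omega_\beta+\omega_\gamma)\,d\beta\,d\gamma$ means \[ \sum_{\sigma_\beta,\sigma_\gamma=\pm1}\int_{\mathcal R_\alpha}F\,\frac{d\mathcal H^1(k_\beta,k_\gamma)}{J}, \] where $\mathcal R_\alpha=\{(k_\beta,k_\gamma)\in(\mathbb R^2\setminus\{0\})^2: k_\alpha+k_\beta+k_\gamma=0,\ \omega_\alpha+\omega_\beta+\omega_\gamma=0\}$,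 $\mathcal H^1$ is one-dimensional Hausdorff measure and $J=\sqrt{\det(DD^{\top})}$ with $D$ the Jacobian matrix in $(k_\beta,k_\gamma)$ of the map $(k_\beta,k_\gamma)\mapsto(\omega_\alpha+\omega_\beta+\omega_\gamma,\ k_\alpha+k_\beta+k_\gamma)\in\mathbb R^3$ (the integral is over the regular part $J\ne0$). The angle of the zero wave vector is undefined; by convention $\mathcal C_\varepsilon(n)(\sigma,0)=0$. Space. For $m\in\mathbb R$, $L^\infty_m$ is the set of (Borel measurable) $n:\{\pm1\}\times\mathbb R^2\to\mathbb R_{\ge0}$ with $\|n\|_{L^\infty_m}=\sup_{\sigma=\pm1}\sup_{k\in\mathbb R^2}\langle k\rangle^m|n(\sigma,k)|<\infty$. We write $n_\alpha=n(\sigma_\alpha,k_\alpha)$. *)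

(* Defs.v *)
From HB Require Import structures.
From mathcomp Require Import all_boot all_order all_algebra.
From mathcomp Require Import all_classical all_reals all_analysis.

Set Implicit Arguments.
Unset Strict Implicit.
Unset Printing Implicit Defensive.

Import Order.TTheory GRing.Theory Num.Theory.
Import numFieldNormedType.Exports.

Local Open Scope classical_set_scope.
Local Open Scope ring_scope.

(* [`|v|] is the sup norm on ['rV_n], so the Euclidean norm is [enorm]. *)
Definition enorm (R : realType) (n : nat) (v : 'rV[R]_n) : R :=
  Num.sqrt (\sum_i v ord0 i ^+ 2).

Notation borel_rV R n := (g_sigma_algebraType (@open 'rV[R]_n)).

Section hausdorff_measure.
Context (R : realType) (n : nat).
Implicit Types (A B X : set 'rV[R]_n) (U : nat -> set 'rV[R]_n).
Local Open Scope ereal_scope.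

(* The added point 0 makes the diameter of the empty set equal to 0. *)
Definition ediam A : \bar R :=
  ereal_sup ([set 0] `|` [set (enorm (x - y)%R)%:E | x in A & y in A]).

Definition hausdorff1_delta (delta : R) A : \bar R :=
  ereal_inf [set \sum_(i <oo) ediam (U i) | U in
    [set U | A `<=` \bigcup_i U i /\ forall i, ediam (U i) <= delta%:E]].

Definition hausdorff1 A : \bar R :=
  ereal_sup [set hausdorff1_delta delta A | delta in [set d : R | (0 < d)%R]].

Lemma ediam_ge0 A : 0 <= ediam A.
Proof. by apply: ereal_sup_ubound; left. Qed.

Lemma ediam0 : ediam set0 = 0.
Proof.
apply/eqP; rewrite eq_le ediam_ge0 andbT.
by apply: ge_ereal_sup => _ [->//|[x []]].
Qed.

Let weight (delta : R) (A : set (g_sigma_algebraType [set: set 'rV[R]_n])) :=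
  if ediam A <= delta%:E then ediam A else +oo.

Let weight0 delta : (0 < delta)%R -> weight delta set0 = 0.
Proof. by move=> d0; rewrite /weight ediam0 lee_fin (ltW d0). Qed.

Let weight_ge0 delta A : 0 <= weight delta A.
Proof. by rewrite /weight; case: ifP => // _; exact: ediam_ge0. Qed.

Let hausdorff1_deltaE delta A : hausdorff1_delta delta A = mu_ext (weight delta) A.
Proof.
apply/eqP; rewrite eq_le; apply/andP; split.
- apply: le_ereal_inf_tmp => _ [U [_ AU] <-].
  have [Usmall|/existsNP[i Ui]] := pselect (forall i, ediam (U i) <= delta%:E).
    apply: ereal_inf_lbound; exists U => //.
    by apply: eq_eseriesr => i _; rewrite /weight Usmall.
  rewrite (@eseries_pinfty _ (fun k => weight delta (U k)) predT i) ?leey//.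
    by move=> k _; rewrite -ltNye (lt_le_trans _ (weight_ge0 _ _)).
  by rewrite /weight; case: ifP.
- apply: le_ereal_inf_tmp => _ [U [AU Usmall] <-].
  apply: ereal_inf_lbound; exists U.
    by split => // i; exact: sub_sigma_algebra.
  by apply: eq_eseriesr => i _; rewrite /weight Usmall.
Qed.

Let hausdorff1_delta_ge0 delta A : 0 <= hausdorff1_delta delta A.
Proof. by rewrite hausdorff1_deltaE mu_ext_ge0. Qed.

Let le_hausdorff1_delta (d e : R) A : (d <= e)%R ->
  hausdorff1_delta e A <= hausdorff1_delta d A.
Proof.
move=> de; apply: le_ereal_inf_tmp => _ [U [AU Usmall] <-].
apply: ereal_inf_lbound; exists U => //; split => // i.
by rewrite (le_trans (Usmall i)).
Qed.

Let hausdorff1_delta_le delta A : (0 < delta)%R ->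
  hausdorff1_delta delta A <= hausdorff1 A.
Proof. by move=> d0; apply: ereal_sup_ubound; exists delta. Qed.

Let hausdorff1_0 : hausdorff1 set0 = 0.
Proof.
apply/eqP; rewrite eq_le; apply/andP; split.
- apply: ge_ereal_sup => _ [d d0 <-].
  by rewrite hausdorff1_deltaE mu_ext0// weight0.
- exact: le_trans (hausdorff1_delta_le _ ltr01).
Qed.

Let hausdorff1_ge0 A : 0 <= hausdorff1 A.
Proof. exact: le_trans (hausdorff1_delta_le _ ltr01). Qed.

Let le_hausdorff1 : {homo hausdorff1 : A B / A `<=` B >-> A <= B}.
Proof.
move=> A B AB; apply: ge_ereal_sup => _ [d d0 <-].
by apply: (le_trans _ (hausdorff1_delta_le _ d0)); rewrite !hausdorff1_deltaE le_mu_ext.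
Qed.

Let hausdorff1_sigma_subadditive : sigma_subadditive hausdorff1.
Proof.
move=> F; apply: ge_ereal_sup => _ [d d0 <-].
rewrite hausdorff1_deltaE.
have := @mu_ext_sigma_subadditive _ (g_sigma_algebraType [set: set 'rV[R]_n])
  R (weight d) (weight_ge0 d) F.
move=> /le_trans; apply.
apply: lee_nneseries => [i _ _|i _]; first exact: mu_ext_ge0.
by rewrite -hausdorff1_deltaE hausdorff1_delta_le.
Qed.

HB.instance Definition _ := isOuterMeasure.Build R 'rV[R]_n hausdorff1
  hausdorff1_0 hausdorff1_ge0 le_hausdorff1 hausdorff1_sigma_subadditive.


Let norm_le_enorm (v : 'rV[R]_n) : (`|v| <= enorm v)%R.
Proof.
rewrite [leLHS]/Num.norm/= mx_normrE; apply/bigmax_leP; split=> [|[i j] _ /=].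
  exact: sqrtr_ge0.
rewrite ord1 -sqrtr_sqr ler_wsqrtr// (bigD1 j)//= lerDl.
by apply: sumr_ge0 => k _; exact: sqr_ge0.
Qed.

Let hausdorff1_separated (d : R) A B : (0 < d)%R ->
    (forall x y, A x -> B y -> (d <= `|x - y|)%R) ->
  hausdorff1 A + hausdorff1 B <= hausdorff1 (A `|` B).
Proof.
move=> d0 AB.
have key e : (0 < e)%R -> (e < d)%R ->
    hausdorff1_delta e A + hausdorff1_delta e B <= hausdorff1_delta e (A `|` B).
  move=> e0 ed; apply: le_ereal_inf_tmp => _ [U [ABU Usmall] <-].
  pose V C i := if pselect (exists x, C x /\ U i x) then U i else set0.
  have ediamV C i : ediam (V C i) <= ediam (U i).
    by rewrite /V; case: pselect => ? //=; rewrite ediam0 ediam_ge0.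
  have HV C : C `<=` A `|` B -> hausdorff1_delta e C <= \sum_(i <oo) ediam (V C i).
    move=> CAB; apply: ereal_inf_lbound; exists (V C) => //; split.
      move=> x Cx; have [i _ Uix] := ABU _ (CAB _ Cx); exists i => //.
      by rewrite /V; case: pselect => //= -[]; exists x.
    by move=> i; exact: le_trans (Usmall i).
  apply: (le_trans (leeD (HV A _) (HV B _))); [exact: subsetUl|exact: subsetUr|].
  rewrite -nneseriesD//; [|by move=> *; exact: ediam_ge0..].
  apply: lee_nneseries => [i _ _|i _]; first by rewrite adde_ge0// ediam_ge0.
  rewrite /V; case: pselect => [[x [Ax Ux]]|?] /=; last first.
    by rewrite ediam0 add0e; case: pselect => ? //=; rewrite ediam0 ediam_ge0.
  case: pselect => [[y [By Uy]]|?] /=; last by rewrite ediam0 adde0.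
  have : (enorm (x - y)%R)%:E <= ediam (U i).
    by apply: ereal_sup_ubound; right; exists x => //; exists y.
  move=> /le_trans /(_ (Usmall i)); rewrite lee_fin leNgt.
  by rewrite (lt_le_trans ed)// (le_trans (AB _ _ Ax By)).
have key2 e f : (0 < e)%R -> (0 < f)%R ->
    hausdorff1_delta e A + hausdorff1_delta f B <= hausdorff1 (A `|` B).
  move=> e0 f0; pose g := Num.min (Num.min e f) (d / 2)%R.
  have g0 : (0 < g)%R by rewrite !lt_min e0 f0 divr_gt0.
  have gd : (g < d)%R.
    by rewrite gt_min; apply/orP; right; rewrite ltr_pdivrMr// ltr_pMr// ltr1n.
  apply: (le_trans _ (hausdorff1_delta_le _ g0)).
  apply: (le_trans _ (key _ g0 gd)); apply: leeD; apply: le_hausdorff1_delta.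
    by rewrite !ge_min lexx.
  by rewrite !ge_min lexx orbT.
have [->|ABoo] := eqVneq (hausdorff1 (A `|` B)) +oo; first exact: leey.
have fin C : C `<=` A `|` B -> hausdorff1 C \is a fin_num.
  move=> CAB; rewrite ge0_fin_numE ?hausdorff1_ge0//.
  by rewrite (le_lt_trans (le_hausdorff1 CAB))// ltey.
have finA := fin A (@subsetUl _ _ _); have finB := fin B (@subsetUr _ _ _).
rewrite -leeBrDr//; apply: ge_ereal_sup => _ [e e0 <-].
have fine_ : hausdorff1_delta e A \is a fin_num.
  rewrite ge0_fin_numE ?hausdorff1_delta_ge0//.
  by rewrite (le_lt_trans (hausdorff1_delta_le _ e0))// ltey_eq finA.
rewrite leeBrDr// -leeBrDl//; apply: ge_ereal_sup => _ [f f0 <-].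
by rewrite leeBrDl// key2.
Qed.

(* The Caratheodory criterion for metric outer measures. *)
Lemma open_hausdorff1_caratheodory (O : set 'rV[R]_n) :
  open O -> caratheodory_measurable hausdorff1 O.
Proof.
move=> oO; apply: le_caratheodory_measurable => X /=.
have [->|Xoo] := eqVneq (hausdorff1 X) +oo; first exact: leey.
have Xfin : hausdorff1 X \is a fin_num by rewrite ge0_fin_numE ?hausdorff1_ge0 ?ltey.
pose s k : R := (k.+1%:R^-1)%R.
have s_gt0 k : (0 < s k)%R by rewrite invr_gt0.
have s_lt k : (s k.+1 < s k)%R by rewrite ltf_pV2 ?posrE// ltr_nat.
pose E k := X `&` O `&` [set x | forall z, ~ O z -> (s k <= `|x - z|)%R].
pose D k := E k.+2 `\` E k.+1.
have EX k : E k `<=` X by move=> x [[]].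
have Efin k : hausdorff1 (E k) \is a fin_num.
  rewrite ge0_fin_numE ?hausdorff1_ge0//.
  by rewrite (le_lt_trans (le_hausdorff1 (EX k)))// ltey.
have leE k : E k `<=` E k.+1.
  by move=> x [XOx Ex]; split => // z /Ex; exact/le_trans/ltW.
have EC k : hausdorff1 (E k) + hausdorff1 (X `&` ~` O) <= hausdorff1 X.
  apply: (le_trans (@hausdorff1_separated (s k) _ _ _ _)) => //.
    by move=> x y [_ Ex] [_ /Ex].
  by apply: le_hausdorff1; rewrite subUset; split => //; exact: subIsetl.
have ED k : hausdorff1 (E k) + hausdorff1 (D k) <= hausdorff1 (E k.+2).
  have sk : (0 < s k - s k.+1)%R by rewrite subr_gt0.
  apply: (le_trans (@hausdorff1_separated (s k - s k.+1) _ _ sk _)).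
    move=> x y [_ Ex] [[XOy _] Ey].
    have [z [Oz yz]] : exists z, ~ O z /\ (`|y - z| < s k.+1)%R.
      apply: contrapT => /forallNP yN; apply: Ey; split => // z Oz.
      by rewrite leNgt; apply/negP => yz; apply: (yN z).
    rewrite lerBlDr (le_trans (Ex _ Oz))//.
    by rewrite (le_trans (ler_distD y _ _))// lerD2l ltW.
  by apply: le_hausdorff1; rewrite subUset; split=> [x /leE/leE//|x []].
have sumD N : \sum_(0 <= k < N) hausdorff1 (D k) <=
    hausdorff1 (E N) + hausdorff1 (E N.+1).
  elim: N => [|N IH]; first by rewrite big_nil adde_ge0 ?hausdorff1_ge0.
  rewrite big_nat_recr//= (le_trans (leeD2r _ IH))// addeAC addeC.
  by apply: leeD2l; exact: ED.
have tailD : \sum_(N <= k <oo) hausdorff1 (D k) @[N --> \oo] --> 0.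
  apply: nneseries_tail_cvg => [|k _]; last exact: hausdorff1_ge0.
  apply: (@le_lt_trans _ _ (hausdorff1 X + hausdorff1 X)).
    apply: lime_le; first by apply: is_cvg_nneseries => k _ _; exact: hausdorff1_ge0.
    apply: nearW => N; apply: (le_trans (sumD N)).
    by apply: leeD; exact: le_hausdorff1.
  by rewrite ltey_eq fin_numD Xfin.
have coverE N : X `&` O `<=` E N.+1 `|` \bigcup_(k in ~` `I_N) D k.
  move=> x [Xx Ox].
  have [m] : exists m, E (N.+1 + m)%N x.
    move: oO; rewrite openE => /(_ _ Ox); rewrite /interior -nbhs_ballE.
    move=> [e /= e0 xeO].
    have [m me] : exists m, (s m < e)%R.
      have [m _ me] := near_infty_natSinv_lt (PosNum e0).
      by exists m; apply: (me m) => /=.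
    exists m; split => // z Oz; rewrite leNgt; apply/negP => xz.
    apply: Oz; apply: xeO; rewrite -ball_normE /=.
    apply: (lt_trans xz); apply: le_lt_trans me.
    by rewrite lef_pV2 ?posrE// ler_nat ltnS leq_addl.
  elim: m => [|m IH]; first by rewrite addn0; left.
  rewrite addnS => Ex; have [/IH//|ENx] := pselect (E (N.+1 + m)%N x).
  right; exists (N + m)%N; last by split; rewrite -addSn.
  by rewrite /= ltnNge leq_addr.
have bound N : hausdorff1 (X `&` O) + hausdorff1 (X `&` ~` O) <=
    hausdorff1 X + \sum_(N <= k <oo) hausdorff1 (D k).
  apply: (@le_trans _ _ (hausdorff1 (E N.+1) +
      \sum_(N <= k <oo) hausdorff1 (D k) + hausdorff1 (X `&` ~` O))).
    apply: leeD2r; apply: (le_trans (le_hausdorff1 (coverE N))).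
    apply: (le_trans (outer_measureU2 _ _ _)); apply: leeD2l.
    exact: outer_measure_sigma_subadditive_tail.
  by rewrite addeAC leeD2r.
have cv : hausdorff1 X + \sum_(N <= k <oo) hausdorff1 (D k) @[N --> \oo] -->
    hausdorff1 X + 0.
  apply: cvgeD; [by rewrite fin_num_adde_defl|exact: cvg_cst|exact: tailD].
rewrite -[leRHS]adde0 -(cvg_lim _ cv)//.
apply: lime_ge; first by apply/cvg_ex; exists (hausdorff1 X + 0).
exact: nearW.
Qed.

Lemma borel_hausdorff1_caratheodory (A : set (borel_rV R n)) :
  measurable A -> caratheodory_measurable hausdorff1 A.
Proof.
move: A; apply: smallest_sub => [|O]; last exact: open_hausdorff1_caratheodory.
exact: (@sigma_algebra_measurable _ (caratheodory_type (@hausdorff1))).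
Qed.

Let hausdorff1_semi_sigma_additive :
  semi_sigma_additive (hausdorff1 : set (borel_rV R n) -> \bar R).
Proof.
move=> F mF tF mUF; apply: caratheodory_measure_sigma_additive => //.
- by move=> i; exact: borel_hausdorff1_caratheodory.
- exact: borel_hausdorff1_caratheodory.
Qed.

HB.instance Definition _ := isMeasure.Build _ (borel_rV R n) R
  (hausdorff1 : set (borel_rV R n) -> \bar R)
  hausdorff1_0 hausdorff1_ge0 hausdorff1_semi_sigma_additive.

End hausdorff_measure.

Section collision.
Context (R : realType).
Implicit Types (k : 'rV[R]_2).

(* A pair [(s, k)] stands for the mode of sign [(-1) ^+ s] and wave vector [k]. *)
Definition mode := (bool * 'rV[R]_2)%type.
Implicit Types (a b g : mode).

Definition sign a : R := (-1) ^+ a.1.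

(* Only [cos], [sin] and 2pi-periodic functions are applied to [angle], so the
   choice of the determination is immaterial. *)
Definition angle k : R :=
  xget 0 [set t | k 0 0 = enorm k * cos t /\ k 0 1 = enorm k * sin t].

Lemma angleP k :
  k 0 0 = enorm k * cos (angle k) /\ k 0 1 = enorm k * sin (angle k).
Proof.
rewrite /angle; case: xgetP => [t _ //|no]; exfalso.
have nE : enorm k ^+ 2 = k 0 0 ^+ 2 + k 0 1 ^+ 2.
  rewrite sqr_sqrtr ?sumr_ge0// => [|i _]; last exact: sqr_ge0.
  by rewrite !big_ord_recl big_ord0 addr0; congr (_ + k _ _ ^+ 2); exact: val_inj.
have [n0|n0] := eqVneq (enorm k) 0.
  move/eqP: nE; rewrite n0 expr0n/= eq_sym paddr_eq0 ?sqr_ge0// !sqrf_eq0.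
  by move=> /andP[/eqP k0 /eqP k1]; apply: (no 0); rewrite /= k0 k1 n0 !mul0r.
pose c := k 0 0 / enorm k.
have kc : k 0 0 = enorm k * c by rewrite mulrC divfK.
have c1 : c ^+ 2 + (k 0 1 / enorm k) ^+ 2 = 1.
  by rewrite !expr_div_n -mulrDl -nE divff// expf_neq0.
have cB : -1 <= c <= 1.
  rewrite -ler_norml -(@ler_pXn2r _ 2)// ?nnegrE// real_normK ?num_real//.
  by rewrite expr1n -c1 lerDl sqr_ge0.
have sE : enorm k * sin (acos c) = `|k 0 1|.
  rewrite sin_acos// -c1 addrAC subrr add0r sqrtr_sqr normrM normfV.
  rewrite (ger0_norm (sqrtr_ge0 _)) mulrC divfK//.
have [k1|k1] := leP 0 (k 0 1).
  by apply: (no (acos c)); rewrite /= acosK// sE ger0_norm.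
by apply: (no (- acos c)); rewrite /= cosN sinN acosK// mulrN sE ltr0_norm// opprK.
Qed.

Definition bracket k : R := Num.sqrt (1 + enorm k ^+ 2).

Definition omega a : R := sign a * a.2 0 0 / enorm a.2.

Definition Gamma a b g : R :=
  pi ^+ 2 *
  (sign a * sin (angle a.2) + sign b * sin (angle b.2) + sign g * sin (angle g.2)) *
  (sign a * enorm a.2 + sign b * enorm b.2 + sign g * enorm g.2).

Definition is_cutoff (eps : R) (chi : R -> R) : Prop :=
  [/\ forall j t, derivable (derive1n j chi) t 1,
      forall t, chi (t + 2 * pi) = chi t,
      forall t, 0 <= chi t <= 1,
      forall t u, `|cos t| = `|cos u| -> chi t = chi u &
      (forall t, `|cos t| < eps \/ `| `|cos t| - 1 / 2| < eps -> chi t = 0) /\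
      (forall t, 2 * eps < `|cos t| -> 2 * eps < `| `|cos t| - 1 / 2| -> chi t = 1)].

Definition collision_integrand (chi : R -> R) (n : mode -> R) a b g : R :=
  Gamma a b g ^+ 2 * omega a *
  chi (angle a.2) * chi (angle b.2) * chi (angle g.2) *
  (omega a * n b * n g + omega g * n a * n b + omega b * n a * n g).

(* A point [p : 'rV_(2 + 2)] is the pair [(k_b, k_g)] of its two halves; [sb]
   and [sg] are the signs of the modes b and g. *)
Definition constraint a (sb sg : bool) (p : 'rV[R]_(2 + 2)) : 'rV[R]_(1 + 2) :=
  row_mx (omega a + omega (sb, lsubmx p) + omega (sg, rsubmx p))%:M
         (a.2 + lsubmx p + rsubmx p).

Definition resonant_set a (sb sg : bool) : set 'rV[R]_(2 + 2) :=
  [set p | [/\ lsubmx p != 0, rsubmx p != 0, a.2 + lsubmx p + rsubmx p = 0 &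
    omega a + omega (sb, lsubmx p) + omega (sg, rsubmx p) = 0]].

(* The library's jacobian matrices act on row vectors, hence the transpose. *)
Definition coarea_factor a (sb sg : bool) (p : 'rV[R]_(2 + 2)) : R :=
  let D := ('J (constraint a sb sg) p)^T in Num.sqrt (\det (D *m D^T)).

(* The value is an extended real because the integrals may a priori diverge. *)
Definition collision (chi : R -> R) (n : mode -> R) a : \bar R :=
  if a.2 == 0 then 0%E else
  (\sum_(sb : bool) \sum_(sg : bool)
    \int[@hausdorff1 R (2 + 2) : {measure set (borel_rV R (2 + 2)) -> \bar R}]_(p in
        resonant_set a sb sg `&` [set p | coarea_factor a sb sg p != 0%R])
      (collision_integrand chi n a (sb, lsubmx p) (sg, rsubmx p)
        / coarea_factor a sb sg p)%:E)%E.

Definition Linf_norm (m : R) (f : mode -> \bar R) : \bar R :=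
  ereal_sup [set ((bracket a.2 `^ m)%:E * `|f a|)%E | a in [set: mode]].

Definition Linf (m : R) : set (mode -> R) :=
  [set n : mode -> R | [/\ forall a, 0 <= n a,
    forall s, measurable_fun [set: borel_rV R 2] (fun k => n (s, k)) &
    (Linf_norm m (EFin \o n) < +oo)%E]].

End collision.

(* Main.v *)
Require Import Defs.
From mathcomp Require Import all_boot all_order all_algebra.
From mathcomp Require Import all_classical all_reals all_analysis measurable_realfun.
From mathcomp Require Import ring lra zify.
Import Order.TTheory GRing.Theory Num.Theory.
Import numFieldNormedType.Exports.
Local Open Scope classical_set_scope.
Local Open Scope ring_scope.

Set Implicit Arguments.
Unset Strict Implicit.
Unset Printing Implicit Defensive.

(** Why the operator is bounded.  Fix a mode [a] with wave vector [k_a <> 0] in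
    the support of the cut-off.  The resonant set and the co-area measure are
    symmetric in the two remaining modes, so call [x] the shorter of their wave
    vectors, [y] the longer one, and put [r = |x|].  On the part of the resonant
    set where the cut-off does not vanish, three estimates hold with constants
    that depend on [eps] only; the sine and the cosine of a vector are those of
    its angle.

    - Transversality: the co-area factor, which is [sqrt 2] times the length of
      the difference of the gradients of the two frequencies, is at least [c / r]
      ([phase_grad_ge], [coarea_factorE]).  It can degenerate only when both
      sines vanish, when [x] is much shorter than [y] and [sin x] vanishes, when
      the three vectors are collinear, or when [k_a] is much shorter than [x] and
      [y].  At such configurations the resonance forces one of the
      cosines to vanish, or [|cos k_a|] to be [1/2] or [2]; the last is absurd and
      the cut-off removes a neighbourhood of the others.
    - Cancellation: [|Gamma| <= C r] ([Gamma_le], [resonant_norm_sum_le]).  If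
      [a] and [y] have opposite signs, the norms of [k_a] and [y] cancel up to
      [r]; if they have the same sign, the resonance says that [cos x] is the sum
      of two nearly opposite cosines, and [eps <= |cos x|] makes all three
      vectors comparable.
    - Length: the part of the resonant set with [rho <= r <= 2 rho] has length at
      most [K rho] ([hausdorff1_shell]).  The resonance function has gradient at
      least [c / rho] and gradient oscillation of order [d / rho ^ 2] at distance
      [d], so in each cell of a grid of mesh [c' rho] the set is a Lipschitz
      graph over a tangent line; the number of cells does not depend on [rho].

    Since [|k_a| <= 2 |y|] and [|x| <= |y|], each of the three quadratic terms of
    the integrand is at most [C N^2 <k_a>^-m <x>^-m], where [N] is the norm of
    the density.  The integrand divided by the co-area factor is therefore at
    most [C N^2 <k_a>^-m r^3 <r>^-m] ([collision_quotient_le]), and summation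
    over dyadic shells ([collision_integral_le]) leaves the series of the
    [rho^4 <rho>^-m], [rho] a power of 2.  It converges at 0, and it converges
    at infinity because [m > 4]. *)

(** * Unit vectors and signs *)

(** Turns the smallness of a product into a case distinction on which factor is
    small; the degenerations of a triad are separated in this way. *)
Lemma small_factor (R : realFieldType) (a b x y : R) : 0 <= a -> 0 <= b ->
  `|x| * `|y| <= a * b -> `|x| <= a \/ `|y| <= b.
Proof.
move=> a0 b0 xy; have [|ax] := leP `|x| a; first by left.
have [|bx] := leP `|y| b; first by right.
by have := ltr_pM a0 b0 ax bx; rewrite ltNge xy.
Qed.

Lemma unit_dot_le1 (R : realFieldType) (a b c d : R) :
  a ^+ 2 + b ^+ 2 = 1 -> c ^+ 2 + d ^+ 2 = 1 -> `|a * c + b * d| <= 1.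
Proof.
move=> ab cd; have := sqr_ge0 (a + c); have := sqr_ge0 (a - c).
have := sqr_ge0 (b + d); have := sqr_ge0 (b - d).
by rewrite ler_norml !sqrrD !sqrrN => *; apply/andP; split; lra.
Qed.

Lemma unit_coord_le1 (R : realFieldType) (a b : R) :
  a ^+ 2 + b ^+ 2 = 1 -> `|a| <= 1 /\ `|b| <= 1.
Proof.
move=> ab; have a0 := sqr_ge0 a; have b0 := sqr_ge0 b.
by split; rewrite -(@ler_pXn2r _ 2)// ?nnegrE// real_normK ?num_real// expr1n; lra.
Qed.

(** Unit vectors with a small cross product are nearly equal or nearly
    opposite, because their dot product [y] satisfies [y ^ 2 = 1 - x ^ 2]; the
    cosine [c] is [y * a - x * b]. *)
Lemma unit_dot_near1 (R : realFieldType) (a b c d h : R) :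
  a ^+ 2 + b ^+ 2 = 1 -> c ^+ 2 + d ^+ 2 = 1 -> 0 <= h <= 1 / 4 -> `|a * d - b * c| <= h ->
  `|c - a| <= 2 * h \/ `|c + a| <= 2 * h.
Proof.
move=> ab cd hh; rewrite !ler_norml => /andP[x1 x2].
pose x := a * d - b * c; pose y := a * c + b * d.
have xy : x ^+ 2 + y ^+ 2 = 1.
  by rewrite /x /y -[RHS](mulr1 1) -{1}ab -cd; ring.
have cE : c = y * a - x * b by rewrite /x /y -[LHS]mulr1 -ab; ring.
have [a1 b1] := unit_coord_le1 ab; have [x1' y1] := unit_coord_le1 xy.
move: a1 b1 y1; rewrite !ler_norml => /andP[a1 a2] /andP[b1 b2] /andP[y1 y2].
have x0 : x ^+ 2 <= h * (1 / 4).
  have : 0 <= (h - x) * (h + x) by apply: mulr_ge0; rewrite /x; lra.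
  have : 0 <= h * (1/4 - h) by apply: mulr_ge0; lra.
  lra.
have xb : - h <= x * b <= h.
  have : `|x * b| <= h * 1.
    by rewrite normrM ler_pM// ler_norml /x; apply/andP; split; lra.
  by rewrite mulr1 ler_norml.
case/andP: xb => xb1 xb2; case/andP: hh => h0 h4.
have [y0|y0] := leP 0 y; [left|right].
  have yh : 1 - y <= h by nra.
  have ya : - h <= (1 - y) * a <= h by apply/andP; split; nra.
  by rewrite cE; apply/andP; split; lra.
have yh : 1 + y <= h by nra.
have ya : - h <= (1 + y) * a <= h by apply/andP; split; nra.
by rewrite cE; apply/andP; split; lra.
Qed.

Lemma norm_signMl (R : realDomainType) (b : bool) (x : R) : `|(-1) ^+ b * x| = `|x|.
Proof. by rewrite normrM normr_sign mul1r. Qed.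

Lemma sign_cases (R : nzRingType) (b : bool) : (-1) ^+ b = 1 :> R \/ (-1) ^+ b = -1 :> R.
Proof. by case: b; [right; rewrite expr1|left; rewrite expr0]. Qed.

Lemma sqr_le_twentieth (R : realFieldType) (h : R) : 0 <= h -> h <= 1 / 20 ->
  h ^+ 2 <= (1 / 20) * h.
Proof. by move=> h0 h20; rewrite expr2 ler_wpM2r. Qed.

Lemma unit_large_coord (R : realFieldType) (a b h : R) :
  a ^+ 2 + b ^+ 2 = 1 -> `|b| <= h -> h <= 1 -> 1 - h <= `|a|.
Proof.
move=> ab bh h1; have [a1 _] := unit_coord_le1 ab.
have b2 : b ^+ 2 <= `|b|.
  rewrite -real_normK ?num_real// expr2 ler_piMl//.
  by have [] := unit_coord_le1 ab.
have a2 : a ^+ 2 <= `|a| by rewrite -real_normK ?num_real// expr2 ler_piMl.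
by lra.
Qed.

(** The triangle inequality for a triangle with sides [l], [t] and [1] whose
    directions are the three unit vectors. *)
Lemma triangle_dist (R : realFieldType) (l t c1 s1 c2 s2 c3 s3 : R) :
  c1 ^+ 2 + s1 ^+ 2 = 1 -> c2 ^+ 2 + s2 ^+ 2 = 1 -> c3 ^+ 2 + s3 ^+ 2 = 1 ->
  0 <= l -> 0 <= t ->
  l * c1 + t * c2 + c3 = 0 -> l * s1 + t * s2 + s3 = 0 -> `|1 - t| <= l.
Proof.
move=> u1 u2 u3 l0 t0 hc hs.
have l2 : l ^+ 2 = t ^+ 2 + 1 + 2 * t * (c2 * c3 + s2 * s3).
  have -> : l ^+ 2 = (l * c1) ^+ 2 + (l * s1) ^+ 2 by rewrite !exprMn -mulrDr u1 mulr1.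
  have -> : l * c1 = - (t * c2 + c3) by lra.
  have -> : l * s1 = - (t * s2 + s3) by lra.
  have e2 : t ^+ 2 * (c2 ^+ 2 + s2 ^+ 2) = t ^+ 2 by rewrite u2 mulr1.
  rewrite !sqrrN; lra.
have := unit_dot_le1 u2 u3; rewrite ler_norml => /andP[d1 _].
rewrite -(@ler_pXn2r _ 2)// ?nnegrE// real_normK ?num_real// l2.
have : 0 <= t * (1 + (c2 * c3 + s2 * s3)) by apply: mulr_ge0; lra.
by rewrite sqrrB; lra.
Qed.

(** * The gradient gap of a resonant triad *)

(** Write [cos i] and [sin i] for the coordinates of the [i]-th unit vector.  If
    [sin 2] and [t * sin 3] are small, then either [sin 3] is small as well,
    so that [|cos 2|] and [|cos 3|] are close to 1 and [|cos 1|] is close to 0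
    or 2; or [t] is small, so that vectors 1 and 3 are nearly opposite, and the
    resonance gives [|cos 2|] close to 0 or [|cos 1|] close to [1/2]. *)
Lemma resonance_sin_not_small (R : realFieldType) (eps h l t c1 s1 c2 s2 c3 s3 : R)
    (b1 b2 b3 : bool) :
  c1 ^+ 2 + s1 ^+ 2 = 1 -> c2 ^+ 2 + s2 ^+ 2 = 1 -> c3 ^+ 2 + s3 ^+ 2 = 1 ->
  l * c1 + t * c2 + c3 = 0 -> l * s1 + t * s2 + s3 = 0 ->
  (-1) ^+ b1 * c1 + (-1) ^+ b2 * c2 + (-1) ^+ b3 * c3 = 0 ->
  0 <= l -> 0 <= t ->
  0 < h -> eps = 20 * h -> eps <= 1 ->
  eps <= `|c1| -> eps <= `| `|c1| - 1 / 2| -> eps <= `|c2| ->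
  `|s2| <= 2 * h -> t * `|s3| <= 4 * h ^+ 2 -> False.
Proof.
move=> u1 u2 u3 hc hs res l0 t0 h0 epsE eps1 ec1 ec1' ec2 s2h ts3.
have [c1' _] := unit_coord_le1 u1.
have [c2' _] := unit_coord_le1 u2.
have [c3' _] := unit_coord_le1 u3.
have c2h : 1 - 2 * h <= `|c2| by apply: (unit_large_coord u2) => //; lra.
have [t2h|s3h] : `|t| <= 2 * h \/ `|s3| <= 2 * h.
  apply: small_factor; [lra|lra|]; rewrite (ger0_norm t0); lra.
- have tl := triangle_dist u1 u2 u3 l0 t0 hc hs.
  have tl' : `|1 - l| <= t.
    by apply: (@triangle_dist _ t l c2 s2 c1 s1 c3 s3) => //; lra.
  have c13 : `|c1 + c3| <= 4 * h.
    have -> : c1 + c3 = (1 - l) * c1 - t * c2 by lra.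
    apply: (le_trans (ler_normB _ _)); rewrite !normrM (ger0_norm t0).
    have : `|1 - l| * `|c1| <= t * 1 by apply: ler_pM.
    have : t * `|c2| <= t * 1 by apply: ler_wpM2l.
    by move: t2h; rewrite (ger0_norm t0); lra.
  have opp_or_same : `|(-1) ^+ b1 * c1 + (-1) ^+ b3 * c3| <= 4 * h \/
      `|(-1) ^+ b1 * c1 - (-1) ^+ b3 * c3| <= 4 * h.
    case: (sign_cases R b1) (sign_cases R b3) => -> [] ->; [left|right|right|left].
    - by rewrite !mul1r.
    - by rewrite !mul1r mulN1r opprK.
    - by rewrite mul1r mulN1r -opprD normrN.
    - by rewrite !mulN1r -opprD normrN.
  move: res opp_or_same c2h c2' ec1'.
  rewrite -(norm_signMl b1 c1) -(norm_signMl b2 c2).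
  move: (_ * c1) (_ * c2) (_ * c3) => d1 d2 d3 res.
  have -> : d2 = - (d1 + d3) by lra.
  rewrite normrN; case=> d13 c2h2 lo hi; first lra.
  have n2 x : 2 * `|x| = `|2 * x| by rewrite normrM ger0_norm.
  have A1 : 2 * `|d1| <= `|d1 + d3| + `|d1 - d3|.
    by rewrite n2 (_ : 2 * d1 = (d1 + d3) + (d1 - d3)) ?ler_normD//; lra.
  have A2 : `|d1 + d3| <= 2 * `|d1| + `|d1 - d3|.
    by rewrite n2 (_ : d1 + d3 = 2 * d1 - (d1 - d3)) ?ler_normB//; lra.
  have : `| `|d1| - 1 / 2| <= 3 * h by rewrite ler_norml; apply/andP; split; lra.
  lra.
- have c3h : 1 - 2 * h <= `|c3| by apply: (unit_large_coord u3) => //; lra.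
  have : (-1) ^+ b1 * c1 = - ((-1) ^+ b2 * c2 + (-1) ^+ b3 * c3) by lra.
  move: (c1') c2h c3h ec1 c2' c3'.
  rewrite -(norm_signMl b1 c1) -(norm_signMl b2 c2) -(norm_signMl b3 c3).
  move: (_ * c1) (_ * c2) (_ * c3) => d1 d2 d3.
  clear - h0 epsE eps1 => c1' c2h c3h ec1 c2' c3' d1E.
  move: c1' c2h c3h ec1 c2' c3'; rewrite d1E normrN; clear - h0 epsE eps1.
  by case: (ger0P d2) => ?; case: (ger0P d3) => ?; case: (ger0P (d2 + d3)) => ? *; lra.
Qed.

(** If vectors 2 and 3 are nearly collinear, then either vector 1 is nearly
    collinear with them, so that the three cosines are equal up to sign and the
    resonance makes an odd multiple of [cos 2] small; or vector 1 is short, so that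
    vectors 2 and 3 nearly cancel.  In the latter case equal signs of 2 and 3
    make [cos 1] small, while opposite signs make the two gradients add up,
    hence [sin 2] is small and [|cos 1|] is close to 2. *)
Lemma resonance_cross_not_small (R : realFieldType) (eps h l t c1 s1 c2 s2 c3 s3 : R)
    (b1 b2 b3 : bool) :
  c1 ^+ 2 + s1 ^+ 2 = 1 -> c2 ^+ 2 + s2 ^+ 2 = 1 -> c3 ^+ 2 + s3 ^+ 2 = 1 ->
  l * c1 + t * c2 + c3 = 0 -> l * s1 + t * s2 + s3 = 0 ->
  (-1) ^+ b1 * c1 + (-1) ^+ b2 * c2 + (-1) ^+ b3 * c3 = 0 ->
  0 <= l -> 0 <= t ->
  0 < h -> eps = 20 * h -> eps <= 1 ->
  eps <= `|c1| -> eps <= `|c2| ->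
  `|c2 * s3 - s2 * c3| <= h ^+ 2 ->
  `|(-1) ^+ b2 * s2 - (-1) ^+ b3 * (t * s3 * (c2 * c3 + s2 * s3))| <= h -> False.
Proof.
move=> u1 u2 u3 hc hs res l0 t0 h0 epsE eps1 ec1 ec2 xh Vh.
have h2h : h ^+ 2 <= h by rewrite expr2 ler_piMl; lra.
have [c2' s2'] := unit_coord_le1 u2.
have [c3' s3'] := unit_coord_le1 u3.
have [lh|yh] : `|l| <= h \/ `|c1 * s2 - s1 * c2| <= h.
  apply: small_factor; [lra|lra|].
  rewrite -normrM -expr2; suff <- : c2 * s3 - s2 * c3 = l * (c1 * s2 - s1 * c2) by [].
  have -> : c3 = - (l * c1 + t * c2) by lra.
  have -> : s3 = - (l * s1 + t * s2) by lra.
  ring.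
- have tl := triangle_dist u1 u2 u3 l0 t0 hc hs.
  rewrite (ger0_norm l0) in lh.
  have tl2 : `|1 - t| <= h by lra.
  have near0 d1 d2 d3 : `|d1| <= 1 -> `|d2| <= 1 -> l * d1 + t * d2 + d3 = 0 ->
      `|d2 + d3| <= 2 * h.
    move=> d1' d2' e; have -> : d2 + d3 = (1 - t) * d2 - l * d1 by lra.
    apply: (le_trans (ler_normB _ _)); rewrite !normrM (ger0_norm l0).
    have : `|1 - t| * `|d2| <= h * 1 by apply: ler_pM.
    have : l * `|d1| <= h * 1 by apply: ler_pM.
    lra.
  have [c1' s1'] := unit_coord_le1 u1.
  have c23 := near0 _ _ _ c1' c2' hc; have s23 := near0 _ _ _ s1' s2' hs.
  have q1 : `|1 + (c2 * c3 + s2 * s3)| <= h.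
    have -> : 1 + (c2 * c3 + s2 * s3) = ((c2 + c3) ^+ 2 + (s2 + s3) ^+ 2) / 2.
      rewrite !sqrrD; lra.
    have E w : `|w| <= 2 * h -> w ^+ 2 <= 4 * h ^+ 2.
      move=> wh; rewrite -real_normK ?num_real//.
      have : `|w| * `|w| <= (2 * h) * (2 * h) by apply: ler_pM.
      by rewrite expr2; lra.
    have := E _ c23; have := E _ s23.
    have h2 : h ^+ 2 <= (1 / 20) * h by apply: sqr_le_twentieth => //; lra.
    rewrite ger0_norm; last first.
      by apply: divr_ge0 => //; apply: addr_ge0; exact: sqr_ge0.
    lra.
  have tsq : `|t * s3 * (c2 * c3 + s2 * s3) + s3| <= 3 * h.
    set q := c2 * c3 + s2 * s3.
    have -> : t * s3 * q + s3 = t * (s3 * (1 + q)) + (1 - t) * s3 by ring.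
    apply: (le_trans (ler_normD _ _)); rewrite !normrM (ger0_norm t0).
    have t2 : t <= 2 by move: tl2; rewrite ler_norml; lra.
    have A1 : t * (`|s3| * `|1 + q|) <= 2 * (1 * h).
      by apply: ler_pM => //; rewrite ?mulr_ge0//; apply: ler_pM.
    have A2 : `|1 - t| * `|s3| <= h * 1 by apply: ler_pM.
    lra.
  have [b23|b23] := eqVneq b3 b2.
  + have c1h : `|c1| <= 2 * h.
      rewrite -(norm_signMl b1) (_ : _ * c1 = - ((-1) ^+ b2 * (c2 + c3))).
        by rewrite normrN norm_signMl.
      by move: res; rewrite b23; clear; lra.
    by clear - c1h ec1 epsE h0; lra.
  + have opp : (-1) ^+ b3 = - (-1) ^+ b2 :> R.
      by move: b23; case: (b2); case: (b3) => //= _; rewrite ?expr1 ?expr0 ?opprK.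
    rewrite opp in res Vh.
    have s2h : `|s2| <= 3 * h.
      rewrite mulNr opprK -mulrDr norm_signMl in Vh.
      move: Vh tsq s23; clear; move: (t * s3 * _) => w; rewrite !ler_norml.
      by move=> /andP[? ?] /andP[? ?] /andP[? ?]; apply/andP; split; lra.
    have c2h : 1 - 3 * h <= `|c2|.
      by apply: (unit_large_coord u2) => //; clear - epsE eps1 h0; lra.
    have : `|c2 - c3| <= 1.
      rewrite -(norm_signMl b2) (_ : _ * (c2 - c3) = - ((-1) ^+ b1 * c1)).
        by rewrite normrN norm_signMl.
      by move: res; clear; lra.
    move: c23 c2h; rewrite ler_normr !ler_norml; clear - epsE eps1 h0.
    by move=> /andP[? ?] /orP[?|?] /andP[? ?]; lra.
- have yh' : `|c2 * s1 - s2 * c1| <= h by rewrite distrC mulrC (mulrC c2).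
  have xh' : `|c2 * s3 - s2 * c3| <= h by lra.
  have hb : 0 <= h <= 1 / 4 by lra.
  have n1 := unit_dot_near1 u2 u1 hb yh'.
  have n3 := unit_dot_near1 u2 u3 hb xh'.
  have dist_sign (b : bool) x : `|x - c2| <= 2 * h \/ `|x + c2| <= 2 * h ->
      `|(-1) ^+ b * x - (-1) ^+ b2 * c2| <= 2 * h \/
      `|(-1) ^+ b * x + (-1) ^+ b2 * c2| <= 2 * h.
    have A1 : `|- x - c2| = `|x + c2| by rewrite -opprD normrN.
    have A2 : `|- x + c2| = `|x - c2| by rewrite addrC distrC.
    by case: (sign_cases R b) (sign_cases R b2) => -> [] ->;
      rewrite ?mul1r ?mulN1r ?opprK ?A1 ?A2; tauto.
  move: res (dist_sign b1 _ n1) (dist_sign b3 _ n3) ec2.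
  rewrite -(norm_signMl b2 c2); move: (_ * c1) (_ * c2) (_ * c3) => d1 d2 d3.
  clear - h0 epsE; rewrite ler_normr !ler_norml.
  move=> res [/andP[? ?]|/andP[? ?]] [/andP[? ?]|/andP[? ?]] /orP[?|?]; lra.
Qed.

(** The vector on the right is [|k_2|] times the difference of the gradients of
    the frequencies 2 and 3.  Pairing it with the direction of vector 2 and with
    that of vector 3 isolates [t * sin 3] and [sin 2], each multiplied by the
    cross product of the two directions: if the vector is small, then either [sin 2]
    or that cross product is small. *)
Lemma resonance_gradient_gap (R : realFieldType) (eps l t c1 s1 c2 s2 c3 s3 : R)
    (b1 b2 b3 : bool) :
  c1 ^+ 2 + s1 ^+ 2 = 1 -> c2 ^+ 2 + s2 ^+ 2 = 1 -> c3 ^+ 2 + s3 ^+ 2 = 1 ->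
  l * c1 + t * c2 + c3 = 0 -> l * s1 + t * s2 + s3 = 0 ->
  (-1) ^+ b1 * c1 + (-1) ^+ b2 * c2 + (-1) ^+ b3 * c3 = 0 ->
  0 <= l -> 0 <= t ->
  0 < eps ->
  eps <= `|c1| -> eps <= `| `|c1| - 1 / 2| -> eps <= `|c2| ->
  (eps / 20) ^+ 8 <= ((-1) ^+ b2 * (s2 * s2) - (-1) ^+ b3 * (t * (s3 * s3))) ^+ 2
                   + ((-1) ^+ b2 * (s2 * c2) - (-1) ^+ b3 * (t * (s3 * c3))) ^+ 2.
Proof.
move=> u1 u2 u3 hc hs res l0 t0 e0 ec1 ec1' ec2.
set h := eps / 20; set V1 := (X in X ^+ 2 + _); set V2 := (X in _ + X ^+ 2).
have epsE : eps = 20 * h by rewrite /h; field.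
have h0 : 0 < h by rewrite /h divr_gt0.
have [c1' _] := unit_coord_le1 u1.
have eps1 : eps <= 1 by lra.
rewrite leNgt; apply/negP => small.
have small1 V W : V ^+ 2 + W ^+ 2 < h ^+ 8 -> `|V| <= h ^+ 4.
  move=> VW; rewrite -(@ler_pXn2r _ 2)// ?nnegrE// ?exprn_ge0// ?ltW//.
  rewrite real_normK ?num_real// -exprM; have := sqr_ge0 W; lra.
have V1h : `|V1| <= h ^+ 4 by apply: small1 small.
have V2h : `|V2| <= h ^+ 4 by apply: (@small1 _ V1); rewrite addrC.
have [c2' s2'] := unit_coord_le1 u2.
have [c3' s3'] := unit_coord_le1 u3.
have h4 : h ^+ 4 = h ^+ 2 * h ^+ 2 by rewrite -exprD.
have comb a b : `|a| <= 1 -> `|b| <= 1 -> `|V1 * a - V2 * b| <= 2 * h ^+ 4.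
  move=> a1 b1'; apply: (le_trans (ler_normB _ _)); rewrite !normrM.
  have : `|V1| * `|a| <= h ^+ 4 * 1 by apply: ler_pM.
  have : `|V2| * `|b| <= h ^+ 4 * 1 by apply: ler_pM.
  lra.
have h20 : 0 <= h ^+ 2 by exact: sqr_ge0.
have h20h : h <= 1 / 20 by clear - epsE eps1; lra.
have h2h := sqr_le_twentieth (ltW h0) h20h.
have h4h : h ^+ 4 <= h ^+ 2.
  by rewrite h4 ler_piMl//; clear - h2h h20h; lra.
have [s2h|xh] : `|s2| <= 2 * h ^+ 2 \/ `|c2 * s3 - s2 * c3| <= h ^+ 2.
  apply: small_factor; [lra|lra|].
  rewrite -normrM -(norm_signMl b2) -mulrA -h4.
  rewrite -normrN (_ : - _ = V1 * c3 - V2 * s3) ?comb//.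
  rewrite /V1 /V2; ring.
- apply: (resonance_sin_not_small u1 u2 u3 hc hs res l0 t0 h0 epsE eps1 ec1 ec1' ec2); first lra.
  rewrite -(ger0_norm t0) -normrM -(norm_signMl b3).
  have -> : (-1) ^+ b3 * (t * s3) =
      (-1) ^+ b2 * (s2 * (s2 * s3 + c2 * c3)) - (V1 * s3 + V2 * c3).
    rewrite /V1 /V2.
    transitivity ((-1) ^+ b3 * (t * s3) * (c3 ^+ 2 + s3 ^+ 2)); first by rewrite u3 mulr1.
    ring.
  apply: (le_trans (ler_normB _ _)); rewrite norm_signMl.
  have : `|s2 * (s2 * s3 + c2 * c3)| <= 2 * h ^+ 2 * 1.
    by rewrite normrM ler_pM// unit_dot_le1//; lra.
  have := comb s3 (- c3) s3' (eq_ind_r (fun z => z <= 1) c3' (normrN c3)).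
  rewrite mulrN opprK; lra.
- apply: (resonance_cross_not_small u1 u2 u3 hc hs res l0 t0 h0 epsE eps1 ec1 ec2 xh).
  have -> : (-1) ^+ b2 * s2 - (-1) ^+ b3 * (t * s3 * (c2 * c3 + s2 * s3)) = V1 * s2 + V2 * c2.
    rewrite /V1 /V2.
    transitivity ((-1) ^+ b2 * s2 * (c2 ^+ 2 + s2 ^+ 2) -
      (-1) ^+ b3 * (t * s3 * (c2 * c3 + s2 * s3))); first by rewrite u2 mulr1.
    ring.
  have := comb s2 (- c2) s2' (eq_ind_r (fun z => z <= 1) c2' (normrN c2)).
  rewrite mulrN opprK; lra.
Qed.

(** * The Euclidean norm of the plane *)

Lemma sum_ord2 (V : nmodType) (F : 'I_2 -> V) : \sum_i F i = F 0 + F 1.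
Proof. by rewrite !big_ord_recl big_ord0 addr0; congr (_ + F _); exact: val_inj. Qed.

Lemma ord2P (P : 'I_2 -> Prop) : P 0 -> P 1 -> forall i, P i.
Proof.
move=> P0 P1 [[|[|//]] i2]; [move: P0|move: P1];
  by congr P; exact: val_inj.
Qed.

Lemma enorm_ge0 (R : realType) n (k : 'rV[R]_n) : 0 <= enorm k.
Proof. exact: sqrtr_ge0. Qed.

Lemma enorm_sqr (R : realType) (k : 'rV[R]_2) : enorm k ^+ 2 = k 0 0 ^+ 2 + k 0 1 ^+ 2.
Proof. by rewrite sqr_sqrtr ?sum_ord2// addr_ge0 ?sqr_ge0. Qed.

Lemma enormE (R : realType) (k : 'rV[R]_2) : enorm k = Num.sqrt (k 0 0 ^+ 2 + k 0 1 ^+ 2).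
Proof. by rewrite -enorm_sqr sqrtr_sqr ger0_norm// enorm_ge0. Qed.

Lemma enorm_gt0 (R : realType) (k : 'rV[R]_2) : k != 0 -> 0 < enorm k.
Proof.
move=> k0; rewrite lt_def enorm_ge0 andbT; apply: contraNneq k0 => kn.
have /esym/eqP := enorm_sqr k; rewrite kn expr0n/= paddr_eq0 ?sqr_ge0// !sqrf_eq0.
move=> /andP[/eqP k00 /eqP k01]; apply/eqP/rowP => i; rewrite mxE.
by move: i; apply: ord2P.
Qed.

Lemma enorm0 (R : realType) : enorm (0 : 'rV[R]_2) = 0.
Proof. by rewrite enormE !mxE expr0n/= addr0 sqrtr0. Qed.

Lemma enormN (R : realType) (k : 'rV[R]_2) : enorm (- k) = enorm k.
Proof. by rewrite !enormE !mxE !sqrrN. Qed.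

Lemma enorm_coord (R : realType) (k : 'rV[R]_2) i : `|k 0 i| <= enorm k.
Proof.
have k0 := sqr_ge0 (k 0 0); have k1 := sqr_ge0 (k 0 1).
by move: i; apply: ord2P; rewrite -sqrtr_sqr enormE ler_wsqrtr; lra.
Qed.

Lemma enorm_le_sum (R : realType) (k : 'rV[R]_2) : enorm k <= `|k 0 0| + `|k 0 1|.
Proof.
rewrite -(@ler_pXn2r _ 2) ?nnegrE ?enorm_ge0 ?addr_ge0//.
rewrite enorm_sqr sqrrD !real_normK ?num_real//.
have : 0 <= `|k 0 0| * `|k 0 1| by apply: mulr_ge0.
by lra.
Qed.

Lemma dot_le_enorm (R : realType) (k l : 'rV[R]_2) :
  `|k 0 0 * l 0 0 + k 0 1 * l 0 1| <= enorm k * enorm l.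
Proof.
rewrite -(@ler_pXn2r _ 2) ?nnegrE ?mulr_ge0 ?enorm_ge0//.
rewrite exprMn !enorm_sqr real_normK ?num_real//.
have := sqr_ge0 (k 0 0 * l 0 1 - k 0 1 * l 0 0); rewrite -subr_ge0.
by set u := (X in 0 <= X -> _); set v := (X in _ -> 0 <= X); rewrite (_ : u = v)// /u /v; ring.
Qed.

Lemma enormD (R : realType) (k l : 'rV[R]_2) : enorm (k + l) <= enorm k + enorm l.
Proof.
rewrite -(@ler_pXn2r _ 2) ?nnegrE ?addr_ge0 ?enorm_ge0//.
rewrite sqrrD !enorm_sqr !mxE.
by have := dot_le_enorm k l; rewrite ler_norml => /andP[_ ?]; lra.
Qed.

Lemma enormB (R : realType) (k l : 'rV[R]_2) : enorm (k - l) = enorm (l - k).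
Proof. by rewrite -enormN opprB. Qed.

Lemma enorm_dist (R : realType) (k l : 'rV[R]_2) : `|enorm k - enorm l| <= enorm (k - l).
Proof.
have h1 := enormD (k - l) l; have h2 := enormD (l - k) k.
rewrite !subrK in h1 h2; rewrite enormB in h2.
by rewrite ler_norml; apply/andP; split; lra.
Qed.

(** * Secant gradients of the resonance function *)

(** The secant version of the gradient of the cosine [k |-> k 0 0 / enorm k]:
    pairing it with [x - y] gives the exact increment, so that one Lipschitz
    estimate serves both as a Taylor formula and as a bound on the variation of
    the gradient. *)
Definition chord_grad (R : realType) (x y : 'rV[R]_2) : 'rV[R]_2 :=
  \row_i ((i == 0)%:R * (enorm x)^-1
          - y 0 0 / enorm y * ((x + y) 0 i / (enorm x + enorm y)) * (enorm x)^-1).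

(** From [|x| - |y| = (x - y) . (x + y) / (|x| + |y|)]. *)
Lemma chord_gradP (R : realType) (x y : 'rV[R]_2) : x != 0 -> y != 0 ->
  x 0 0 / enorm x - y 0 0 / enorm y =
  (x - y) 0 0 * chord_grad x y 0 0 + (x - y) 0 1 * chord_grad x y 0 1.
Proof.
move=> /enorm_gt0 x0 /enorm_gt0 y0; rewrite !mxE /=.
have := enorm_sqr x; have := enorm_sqr y.
set r := enorm x in x0 *; set s := enorm y in y0 *.
move: (x 0 0) (x 0 1) (y 0 0) (y 0 1) => a b c d hy hx.
have rs : r + s != 0 by rewrite gt_eqF// addr_gt0.
transitivity ((a - c) / r - c / s / r / (r + s) * (r ^+ 2 - s ^+ 2)).
  by field; rewrite rs !gt_eqF.
by rewrite hx hy; field; rewrite rs !gt_eqF.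
Qed.

Lemma chord_grad_diag (R : realType) (p : 'rV[R]_2) : p != 0 ->
  chord_grad p p 0 0 = (p 0 1 / enorm p) ^+ 2 / enorm p /\
  chord_grad p p 0 1 = - (p 0 0 / enorm p * (p 0 1 / enorm p)) / enorm p.
Proof.
move=> /enorm_gt0 p0; rewrite !mxE /=; have := enorm_sqr p.
set r := enorm p in p0 *.
move: (p 0 0) (p 0 1) => a b hp.
have r0 : r != 0 by rewrite gt_eqF.
have rr : r + r != 0 by rewrite gt_eqF// addr_gt0.
split; last by field; rewrite r0 rr.
transitivity ((r ^+ 2 - a ^+ 2) / r ^+ 3); first by field; rewrite r0 rr.
by rewrite hp; field.
Qed.

(** The gradient is homogeneous of degree -1, so it varies by [d / rho ^ 2] over
    a distance [d] away from the ball of radius [rho]; each of the factors of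
    [chord_grad] contributes its own variation. *)
Lemma chord_grad_near (R : realType) (rho d : R) (x y p : 'rV[R]_2) i :
  0 < rho -> rho <= enorm x -> rho <= enorm y -> rho <= enorm p ->
  enorm (x - p) <= d -> enorm (y - p) <= d ->
  `|chord_grad x y 0 i - chord_grad p p 0 i| <= 6 * d / rho ^+ 2.
Proof.
move=> rho0 xr yr pr xp yp.
have xpi := le_trans (enorm_coord (x - p) i) xp.
have ypi := le_trans (enorm_coord (y - p) i) yp.
have yp0 := le_trans (enorm_coord (y - p) 0) yp.
have rq := le_trans (enorm_dist x p) xp.
have sq := le_trans (enorm_dist y p) yp.
have y1 := enorm_coord y 0; have p1 := enorm_coord p i; have p01 := enorm_coord p 0.
have xi := enorm_coord x i; have yi := enorm_coord y i.
have d0 : 0 <= d by rewrite (le_trans _ rq).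
rewrite !mxE in xpi ypi yp0 *.
move: (enorm x) (enorm y) (enorm p) xr yr pr rq sq y1 p1 p01 xi yi => r s q.
move: (x 0 i) (y 0 i) (p 0 i) (y 0 0) (p 0 0) xpi ypi yp0 => xi yi pi y0 p0.
move=> xpi ypi yp0 xr yr pr rq sq y1 p1 p01 xi1 yi1.
have r0 : 0 < r by lra. have s0 : 0 < s by lra. have q0 : 0 < q by lra.
have nr := gt_eqF r0; have ns := gt_eqF s0; have nq := gt_eqF q0.
have rs0 : 0 < r + s by lra. have nrs := gt_eqF rs0.
have nqq : q + q != 0 by rewrite gt_eqF//; lra.
have rV : `|r^-1| <= rho^-1 by rewrite gtr0_norm ?invr_gt0// lef_pV2.
have qV : `|q^-1| <= rho^-1 by rewrite gtr0_norm ?invr_gt0// lef_pV2.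
have rhoV : 0 < rho^-1 by rewrite invr_gt0.
set e := d / rho.
have e0 : 0 <= e by rewrite divr_ge0// ltW.
have dA : `|r^-1 - q^-1| <= e * rho^-1.
  have -> : r^-1 - q^-1 = (q - r) * q^-1 * r^-1 by field; rewrite nr nq.
  rewrite !normrM; apply: ler_pM => //.
  by apply: ler_pM => //; rewrite distrC.
have dc : `|y0 / s - p0 / q| <= 2 * e.
  have -> : y0 / s - p0 / q = ((y0 - p0) + p0 / q * (q - s)) / s.
    by field; rewrite ns nq.
  rewrite normrM /e mulrA; apply: ler_pM => //.
    apply: (le_trans (ler_normD _ _)); rewrite normrM.
    rewrite [X in _ <= X](_ : _ = d + 1 * d); last by ring.
    apply: lerD => //; apply: ler_pM => //; last by rewrite distrC.
    by rewrite normrM normfV (gtr0_norm q0) ler_pdivrMr// mul1r.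
  by rewrite gtr0_norm ?invr_gt0// lef_pV2.
have dB : `|(xi + yi) / (r + s) - (pi + pi) / (q + q)| <= 2 * e.
  have -> : (xi + yi) / (r + s) - (pi + pi) / (q + q) =
      ((xi - pi) + (yi - pi) + pi / q * ((q - r) + (q - s))) / (r + s).
    by field; rewrite nq nrs nqq.
  have -> : 2 * e = (4 * d) * (2 * rho)^-1 by rewrite /e; field; rewrite gt_eqF.
  rewrite normrM; apply: ler_pM => //.
    apply: (le_trans (ler_normD _ _)).
    rewrite [X in _ <= X](_ : _ = (d + d) + 1 * (d + d)); last by ring.
    apply: lerD; first by apply: (le_trans (ler_normD _ _)); exact: lerD.
    rewrite normrM; apply: ler_pM => //.
      by rewrite normrM normfV (gtr0_norm q0) ler_pdivrMr// mul1r.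
    by apply: (le_trans (ler_normD _ _)); apply: lerD; rewrite distrC.
  by rewrite gtr0_norm ?invr_gt0// lef_pV2 ?posrE ?mulr_gt0//; lra.
have c1 : `|p0 / q| <= 1 by rewrite normrM normfV (gtr0_norm q0) ler_pdivrMr// mul1r.
have B1 : `|(xi + yi) / (r + s)| <= 1.
  rewrite normrM normfV (gtr0_norm rs0) ler_pdivrMr// mul1r.
  by apply: (le_trans (ler_normD _ _)); exact: lerD.
have B2 : `|(pi + pi) / (q + q)| <= 1.
  have qq0 : 0 < q + q by lra.
  rewrite normrM normfV (gtr0_norm qq0) ler_pdivrMr// mul1r.
  by apply: (le_trans (ler_normD _ _)); exact: lerD.
move: (y0 / s) (p0 / q) (_ / (r + s)) (_ / (q + q)) dA dc dB c1 B1 B2 rV qV => c c' b b'.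
move: r^-1 q^-1 => u u' dA dc dB c1 B1 B2 rV qV.
have -> : (i == 0)%:R * u - c * b * u - ((i == 0)%:R * u' - c' * b' * u') =
   (i == 0)%:R * (u - u') - (c - c') * b * u - c' * (b - b') * u - c' * b' * (u - u') by ring.
have -> : 6 * d / rho ^+ 2 = 1 * (e * rho^-1) + 2 * e * 1 * rho^-1 + 1 * (2 * e) * rho^-1
   + 1 * 1 * (e * rho^-1) by rewrite /e; field; rewrite gt_eqF.
apply: (le_trans (ler_normB _ _)); apply: lerD.
  apply: (le_trans (ler_normB _ _)); apply: lerD.
    apply: (le_trans (ler_normB _ _)); apply: lerD.
      by rewrite normrM; apply: ler_pM => //; case: (i == 0); rewrite ?normr1 ?normr0.
    rewrite !normrM; apply: ler_pM => //; exact: ler_pM.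
  rewrite !normrM; apply: ler_pM => //; exact: ler_pM.
by rewrite !normrM; apply: ler_pM => //; exact: ler_pM.
Qed.

(** The gradient in [x], along [x + y] constant, of the sum of the two
    frequencies. *)
Definition phase_grad (R : realType) (sx sy : bool) (x y : 'rV[R]_2) : 'rV[R]_2 :=
  (-1) ^+ sx *: chord_grad x x - (-1) ^+ sy *: chord_grad y y.

Lemma phase_gradE (R : realType) (sx sy : bool) (x y : 'rV[R]_2) i :
  phase_grad sx sy x y 0 i =
  (-1) ^+ sx * chord_grad x x 0 i - (-1) ^+ sy * chord_grad y y 0 i.
Proof. by rewrite /phase_grad mxE [X in X + _]mxE [X in _ + X]mxE [X in _ - X]mxE. Qed.

Lemma phase_grad_ge (R : realType) (eps : R) (a : mode R) (sx sy : bool) (x y : 'rV[R]_2) :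
  0 < eps -> a.2 != 0 -> x != 0 -> y != 0 -> a.2 + x + y = 0 ->
  omega a + omega (sx, x) + omega (sy, y) = 0 ->
  eps <= `|a.2 0 0 / enorm a.2| -> eps <= `| `|a.2 0 0 / enorm a.2| - 1 / 2| ->
  eps <= `|x 0 0 / enorm x| ->
  (eps / 20) ^+ 4 <= enorm x * enorm (phase_grad sx sy x y).
Proof.
move=> eps0 an xn yn sum0 res ea ea' ex.
have := chord_grad_diag xn; have := chord_grad_diag yn.
have a0 := enorm_gt0 an; have x0 := enorm_gt0 xn; have y0 := enorm_gt0 yn.
have unit (k : 'rV[R]_2) : 0 < enorm k ->
    (k 0 0 / enorm k) ^+ 2 + (k 0 1 / enorm k) ^+ 2 = 1.
  by move=> k0; rewrite !expr_div_n -mulrDl -enorm_sqr divff// expf_neq0// gt_eqF.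
have sum0i i : a.2 0 i + x 0 i + y 0 i = 0 by move/rowP/(_ i): sum0; rewrite !mxE.
move=> [gy0 gy1] [gx0 gx1].
have l0 : 0 <= enorm a.2 / enorm y by rewrite divr_ge0 ?ltW.
have t0 : 0 <= enorm x / enorm y by rewrite divr_ge0 ?ltW.
have hc : enorm a.2 / enorm y * (a.2 0 0 / enorm a.2) +
    enorm x / enorm y * (x 0 0 / enorm x) + y 0 0 / enorm y = 0.
  transitivity ((a.2 0 0 + x 0 0 + y 0 0) / enorm y); first by field; rewrite !gt_eqF.
  by rewrite sum0i mul0r.
have hs : enorm a.2 / enorm y * (a.2 0 1 / enorm a.2) +
    enorm x / enorm y * (x 0 1 / enorm x) + y 0 1 / enorm y = 0.
  transitivity ((a.2 0 1 + x 0 1 + y 0 1) / enorm y); first by field; rewrite !gt_eqF.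
  by rewrite sum0i mul0r.
have gap := resonance_gradient_gap (b1 := a.1) (b2 := sx) (b3 := sy)
  (unit _ a0) (unit _ x0) (unit _ y0) hc hs.
rewrite -(@ler_pXn2r _ 2) ?nnegrE ?mulr_ge0 ?enorm_ge0 ?exprn_ge0 ?divr_ge0 ?(ltW eps0)//.
rewrite -exprM [X in _ <= X]exprMn [X in _ <= _ * X]enorm_sqr.
have res' : (-1) ^+ a.1 * (a.2 0 0 / enorm a.2) + (-1) ^+ sx * (x 0 0 / enorm x) +
  (-1) ^+ sy * (y 0 0 / enorm y) = 0 by move: res; rewrite /omega /sign /= !mulrA.
apply: (le_trans (gap _ res' l0 t0 eps0 ea ea' ex)).
have mxl i : phase_grad sx sy x y 0 i =
    (-1) ^+ sx * chord_grad x x 0 i - (-1) ^+ sy * chord_grad y y 0 i.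
  exact: phase_gradE.
rewrite !mxl gx0 gx1 gy0 gy1 mulrDr -!exprMn.
rewrite le_eqVlt; apply/orP; left; apply/eqP; congr (_ ^+ 2 + _).
  by field; rewrite !gt_eqF.
rewrite -[LHS]sqrrN; congr (_ ^+ 2).
by field; rewrite !gt_eqF.
Qed.

Lemma enorm_gt0_neq0 (R : realType) (k : 'rV[R]_2) : 0 < enorm k -> k != 0.
Proof. by apply: contraTneq => ->; rewrite enorm0 ltxx. Qed.

(** Clearing the denominators turns the resonance condition into a condition on
    functions that are continuous on the whole space. *)
Lemma resonance_clear (R : realType) (a : mode R) (sx sy : bool) (x y : 'rV[R]_2) :
  x != 0 -> y != 0 ->
  (omega a + omega (sx, x) + omega (sy, y) = 0) <->
  (omega a * (enorm x * enorm y) + (-1) ^+ sx * x 0 0 * enorm y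
    + (-1) ^+ sy * y 0 0 * enorm x = 0).
Proof.
move=> /enorm_gt0/gt_eqF x0 /enorm_gt0/gt_eqF y0.
rewrite [omega (sx, x)]/omega [omega (sy, y)]/omega /sign /=.
have <- : (omega a + (-1) ^+ sx * x 0 0 / enorm x + (-1) ^+ sy * y 0 0 / enorm y) *
    (enorm x * enorm y) =
  omega a * (enorm x * enorm y) + (-1) ^+ sx * x 0 0 * enorm y
    + (-1) ^+ sy * y 0 0 * enorm x by field; rewrite x0 y0.
split=> [->|/eqP]; first by rewrite mul0r.
by rewrite !mulf_eq0 x0 y0 !orbF => /eqP.
Qed.

(** Two pairs with the same sum differ by opposite vectors, so that the two
    secant gradients are subtracted. *)
Lemma phase_chord (R : realType) (sx sy : bool) (x y x' y' : 'rV[R]_2) :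
  x != 0 -> y != 0 -> x' != 0 -> y' != 0 -> x + y = x' + y' ->
  omega (sx, x) + omega (sy, y) - (omega (sx, x') + omega (sy, y')) =
  (x - x') 0 0 * ((-1) ^+ sx * chord_grad x x' 0 0 - (-1) ^+ sy * chord_grad y y' 0 0) +
  (x - x') 0 1 * ((-1) ^+ sx * chord_grad x x' 0 1 - (-1) ^+ sy * chord_grad y y' 0 1).
Proof.
move=> x0 y0 x'0 y'0 xy; have hx := chord_gradP x0 x'0; have hy := chord_gradP y0 y'0.
have yx : y - y' = - (x - x').
  have -> : y = x' + y' - x by rewrite -xy addrC addKr.
  by rewrite opprB addrAC addrK.
rewrite /omega /sign /=.
transitivity ((-1) ^+ sx * (x 0 0 / enorm x - x' 0 0 / enorm x')
  + (-1) ^+ sy * (y 0 0 / enorm y - y' 0 0 / enorm y')); first by ring.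
rewrite hx hy yx; have opp i : (- (x - x')) 0 i = - ((x - x') 0 i) by rewrite mxE.
by rewrite !opp; ring.
Qed.

Lemma phase_grad_near (R : realType) (rho d : R) (sx sy : bool)
    (x y x' y' u v : 'rV[R]_2) i :
  0 < rho -> rho <= enorm x -> rho <= enorm x' -> rho <= enorm u ->
  rho <= enorm y -> rho <= enorm y' -> rho <= enorm v ->
  enorm (x - u) <= d -> enorm (x' - u) <= d ->
  enorm (y - v) <= d -> enorm (y' - v) <= d ->
  `|(-1) ^+ sx * chord_grad x x' 0 i - (-1) ^+ sy * chord_grad y y' 0 i
    - phase_grad sx sy u v 0 i| <= 12 * d / rho ^+ 2.
Proof.
move=> r0 hx hx' hu hy hy' hv xu x'u yv y'v; rewrite phase_gradE.
set A := chord_grad x x' 0 i; set B := chord_grad y y' 0 i.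
set C := chord_grad u u 0 i; set D := chord_grad v v 0 i.
have -> : (-1) ^+ sx * A - (-1) ^+ sy * B - ((-1) ^+ sx * C - (-1) ^+ sy * D) =
  (-1) ^+ sx * (A - C) - (-1) ^+ sy * (B - D) by ring.
apply: (le_trans (ler_normB _ _)); rewrite !norm_signMl.
have -> : 12 * d / rho ^+ 2 = 6 * d / rho ^+ 2 + 6 * d / rho ^+ 2 by lra.
by apply: lerD; apply: chord_grad_near.
Qed.

(** * Length of the resonant set in a dyadic shell *)

Lemma ediam_le (R : realType) n (A : set 'rV[R]_n) (c : R) : 0 <= c ->
  (forall p q, A p -> A q -> enorm (p - q) <= c) -> (ediam A <= c%:E)%E.
Proof.
move=> c0 Ac; apply: ge_ereal_sup => _ [->|[p Ap [q Aq <-]]]; rewrite lee_fin//.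
exact: Ac.
Qed.

(** The last slab, of index [N], only serves the endpoint [x = a + N * d]. *)
Lemma slab_index (R : realType) (a d x : R) N : 0 < d -> a <= x <= a + N%:R * d ->
  exists2 i, (i < N.+1)%N & a + i%:R * d <= x <= a + i.+1%:R * d.
Proof.
move=> d0 /andP[ax xN]; pose y := (x - a) / d.
have y0 : 0 <= y by rewrite divr_ge0 ?subr_ge0// ltW.
have xE : x = a + y * d by rewrite /y divfK ?gt_eqF//; ring.
have /andP[iy yi] := truncn_itv y0.
exists (Num.truncn y).
  rewrite ltnS -(ler_nat R) (le_trans iy)// /y ler_pdivrMr//; lra.
by rewrite xE !lerD2l !ler_pM2r// iy ltW.
Qed.

(** A set on which the real function [t] has an [L]-Lipschitz inverse is covered
    by the pieces where [t] lies in a short interval.  The factor 2 absorbs the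
    extra piece at the endpoint of the range. *)
Lemma hausdorff1_lipschitz (R : realType) n (S : set 'rV[R]_n) (t : 'rV[R]_n -> R)
    (a l L : R) : 0 <= L -> 0 < l ->
  (forall p, S p -> a <= t p <= a + l) ->
  (forall p q, S p -> S q -> enorm (p - q) <= L * `|t p - t q|) ->
  (hausdorff1 S <= (2 * L * l)%:E)%E.
Proof.
move=> L0 l0 St SL; apply: ge_ereal_sup => _ [d /= d0 <-].
pose N := (Num.truncn (L * l / d)).+1.
have N0 : 0 < N%:R :> R by rewrite ltr0n.
have Nd : L * (l / N%:R) <= d.
  rewrite mulrA ler_pdivrMr// -ler_pdivrMl// mulrC ltW//.
  by have /andP[] := truncn_itv (divr_ge0 (mulr_ge0 L0 (ltW l0)) (ltW d0)).
pose e := l / N%:R; have e0 : 0 < e by rewrite divr_gt0.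
have Le0 : 0 <= L * e by rewrite mulr_ge0// ltW.
pose U i := if (i < N.+1)%N then
  S `&` [set p | a + i%:R * e <= t p <= a + i.+1%:R * e] else set0.
have dU i : (ediam (U i) <= (L * e)%:E)%E.
  rewrite /U; case: ifP => _; last by rewrite ediam0 lee_fin.
  apply: ediam_le => // p q [Sp /andP[p1 p2]] [Sq /andP[q1 q2]].
  apply: (le_trans (SL _ _ Sp Sq)); rewrite ler_wpM2l//.
  by move: p1 p2 q1 q2; rewrite -natr1 ler_norml => *; apply/andP; split; lra.
apply: (@le_trans _ _ (\sum_(i <oo) ediam (U i))%E).
  apply: ereal_inf_lbound; exists U => //; split; last first.
    by move=> i; apply: (le_trans (dU i)); rewrite lee_fin.
  move=> p Sp; have := St _ Sp; rewrite (_ : l = N%:R * e); last first.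
    by rewrite /e mulrC divfK// gt_eqF.
  by move=> /(slab_index e0)[i iN ti]; exists i => //; rewrite /U iN.
rewrite (@nneseries_split _ _ 0 N.+1) => [|k _]; last exact: ediam_ge0.
rewrite add0n eseries0 ?adde0 => [|i Ni _]; last by rewrite /U ltnNge Ni/= ediam0.
apply: (@le_trans _ _ (\sum_(0 <= k < N.+1) (L * e)%:E)%E).
  by apply: lee_sum => i _; exact: dU.
rewrite sumEFin lee_fin sumr_const_nat subn0 -mulr_natl -natr1.
have : N%:R * e = l by rewrite /e mulrC divfK// gt_eqF.
have : 1 <= N%:R :> R by rewrite ler1n.
have : 0 <= (N%:R - 1) * (L * e) by rewrite mulr_ge0// subr_ge0 ler1n.
move=> A _ B; rewrite -B; lra.
Qed.

Lemma hausdorff1_slices (R : realType) n (S : set 'rV[R]_n) (g : 'rV[R]_n -> R)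
    (a d c : R) N : 0 < d ->
  (forall p, S p -> a <= g p <= a + N%:R * d) ->
  (forall b, (hausdorff1 (S `&` [set p | (b <= g p <= b + d)%R]) <= c%:E)%E) ->
  (hausdorff1 S <= (N.+1%:R * c)%:E)%E.
Proof.
move=> d0 Sg Sc.
pose F (i : nat) := S `&` [set p | a + i%:R * d <= g p <= a + i%:R * d + d].
have SF : S `<=` \big[setU/set0]_(i < N.+1) F i.
  move=> p Sp; have [i iN gi] := slab_index d0 (Sg _ Sp).
  rewrite -bigcup_mkord; exists i => //; split => //=.
  by move: gi; rewrite -natr1 mulrDl mul1r addrA.
apply: (le_trans (le_outer_measure _ _ _ SF)).
apply: (le_trans (outer_measure_subadditive _ _ _)).
apply: (@le_trans _ _ (\sum_(i < N.+1) c%:E)%E); first by apply: lee_sum => i _; exact: Sc.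
by rewrite sumEFin lee_fin sumr_const card_ord mulr_natl.
Qed.

(** All the conditions are closed and stated without denominators, which makes
    the shell a closed set.  Both the pair of halves [(k_b, k_g)] of a point and
    the swapped pair are used for [(X, Y)]. *)
Definition resonant_shell (R : realType) n (eps : R) (a : mode R) (sx sy : bool)
    (X Y : 'rV[R]_n -> 'rV[R]_2) (rho : R) : set 'rV[R]_n :=
  [set p | [/\ a.2 + X p + Y p = 0,
    omega a * (enorm (X p) * enorm (Y p)) + (-1) ^+ sx * X p 0 0 * enorm (Y p)
      + (-1) ^+ sy * Y p 0 0 * enorm (X p) = 0,
    rho <= enorm (X p) <= 2 * rho, enorm (X p) <= enorm (Y p) &
    eps * enorm (X p) <= `|X p 0 0|]].

(** In a cell so small that the gradient of the resonance function varies by less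
    than half its length, differences of points of the shell make a definite
    angle with the gradient [v] at a fixed point; hence the coordinate
    orthogonal to [v] has a Lipschitz inverse. *)
Lemma hausdorff1_shell_cell (R : realType) n (eps : R) (a : mode R) (sx sy : bool)
    (X Y : 'rV[R]_n -> 'rV[R]_2) (rho d b0 b1 : R) :
  (forall p q, enorm (p - q) ^+ 2 = enorm (X p - X q) ^+ 2 + enorm (Y p - Y q) ^+ 2) ->
  0 < eps -> a.2 != 0 ->
  eps <= `|a.2 0 0 / enorm a.2| -> eps <= `| `|a.2 0 0 / enorm a.2| - 1 / 2| ->
  0 < rho -> 0 < d -> 192 * d <= rho * (eps / 20) ^+ 4 ->
  (hausdorff1 (resonant_shell eps a sx sy X Y rho
     `&` [set p | (b0 <= X p 0 0 <= b0 + d)%R]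
     `&` [set p | (b1 <= X p 0 1 <= b1 + d)%R]) <= (16 * d)%:E)%E.
Proof.
move=> XY eps0 an ea ea' rho0 d0 drho; set S := _ `&` _.
have [[p0 Sp0]|S0] := pselect (exists p, S p); last first.
  have -> : S = set0 by apply/seteqP; split=> // p Sp; apply: S0; exists p.
  by rewrite outer_measure0 lee_fin mulr_ge0// ltW.
have Sres p : S p -> [/\ X p != 0, Y p != 0, a.2 + X p + Y p = 0,
    omega a + omega (sx, X p) + omega (sy, Y p) = 0 &
    [/\ rho <= enorm (X p), rho <= enorm (Y p), enorm (X p) <= 2 * rho &
     eps <= `|X p 0 0 / enorm (X p)|]].
  move=> [[[h1 h2 /andP[h3 h4] h5 h6] _] _].
  have x0 : 0 < enorm (X p) by lra.
  have y0 : 0 < enorm (Y p) by lra.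
  have xn := enorm_gt0_neq0 x0; have yn := enorm_gt0_neq0 y0.
  split=> //; first exact/(resonance_clear a sx sy xn yn).
  split=> //; first by lra.
  by rewrite normrM normfV (gtr0_norm x0) ler_pdivlMr.
have Sclose p q : S p -> S q -> enorm (X p - X q) <= 2 * d.
  move=> [[_ /andP[? ?]] /andP[? ?]] [[_ /andP[? ?]] /andP[? ?]].
  apply: (le_trans (enorm_le_sum _)); rewrite !mxE.
  rewrite (_ : 2 * d = d + d); last lra.
  by apply: lerD; rewrite ler_norml; apply/andP; split; lra.
have Ydiff p q : S p -> S q -> Y p - Y q = - (X p - X q).
  move=> /Sres[_ _ hp _ _] /Sres[_ _ hq _ _].
  have -> : Y p = - (a.2 + X p) by apply/eqP; rewrite -addr_eq0 addrC hp.
  have -> : Y q = - (a.2 + X q) by apply/eqP; rewrite -addr_eq0 addrC hq.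
  by rewrite opprK opprB addrC opprD addrACA subrr add0r.
pose v := phase_grad sx sy (X p0) (Y p0); set N := enorm v.
have [x0n y0n sum0 res0 [x0r y0r x02 x0e]] := Sres _ Sp0.
have gap := phase_grad_ge eps0 an x0n y0n sum0 res0 ea ea' x0e.
have N2 : (eps / 20) ^+ 4 <= 2 * rho * N.
  by apply: (le_trans gap); rewrite ler_wpM2r// enorm_ge0.
have N0 : 0 < N.
  have : 0 < (eps / 20) ^+ 4 by rewrite exprn_gt0// divr_gt0.
  move=> /lt_le_trans/(_ N2); rewrite pmulr_rgt0// mulr_gt0//.
have Nn : N != 0 by rewrite gt_eqF.
(* The secant gradients of two points of S annihilate their difference, and
   differ from v by at most half the length of v: v is at least h / (2 rho) for
   h = (eps / 20) ^ 4, which is where the number 192 comes from. *)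
have tangent p q : S p -> S q ->
    `|(X p - X q) 0 0 * v 0 0 + (X p - X q) 0 1 * v 0 1| <= N / 2 * enorm (X p - X q).
  move=> Sp Sq.
  have [xp yp sp rp [xpr ypr _ _]] := Sres _ Sp.
  have [xq yq sq rq [xqr yqr _ _]] := Sres _ Sq.
  have xyE : X p + Y p = X q + Y q.
    by apply: (@addrI _ a.2); rewrite !addrA sp sq.
  have := phase_chord sx sy xp yp xq yq xyE.
  rewrite (_ : _ - _ = 0); last by rewrite -[RHS]subr0 -{1}rp -rq; ring.
  have near i := phase_grad_near sx sy i rho0 xpr xqr x0r ypr yqr y0r
    (Sclose _ _ Sp Sp0) (Sclose _ _ Sq Sp0).
  have yp0 : enorm (Y p - Y p0) <= 2 * d by rewrite Ydiff// enormN Sclose.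
  have yq0 : enorm (Y q - Y p0) <= 2 * d by rewrite Ydiff// enormN Sclose.
  move: (near 0 yp0 yq0) (near 1 yp0 yq0).
  rewrite -/v; set g0 := (X in `|X - v 0 0|); set g1 := (X in `|X - v 0 1|).
  move=> e0 e1 chord0.
  set w := X p - X q in chord0 *.
  have -> : w 0 0 * v 0 0 + w 0 1 * v 0 1 = - (w 0 0 * (g0 - v 0 0) + w 0 1 * (g1 - v 0 1)).
    by move: chord0; rewrite -/g0 -/g1; lra.
  rewrite normrN; apply: (le_trans (ler_normD _ _)); rewrite !normrM.
  set e := 12 * (2 * d) / rho ^+ 2 in e0 e1.
  have W0 : `|w 0 0| * `|g0 - v 0 0| <= enorm w * e by apply: ler_pM => //; exact: enorm_coord.
  have W1 : `|w 0 1| * `|g1 - v 0 1| <= enorm w * e by apply: ler_pM => //; exact: enorm_coord.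
  apply: (le_trans (lerD W0 W1)); rewrite -mulrDr mulrC ler_wpM2r ?enorm_ge0//.
  rewrite /e -mulrDl ler_pdivrMr ?exprn_gt0//.
  have : 192 * d <= rho * (2 * rho * N) by apply: (le_trans drho); rewrite ler_pM2l.
  by rewrite expr2; lra.
pose t p := (v 0 0 * X p 0 1 - v 0 1 * X p 0 0) / N.
have tB p q : t p - t q = (v 0 0 * (X p - X q) 0 1 - v 0 1 * (X p - X q) 0 0) / N.
  have wE i : (X p - X q) 0 i = X p 0 i - X q 0 i by rewrite !mxE.
  by rewrite !wE /t; ring.
have lagrange (w : 'rV[R]_2) : N ^+ 2 * enorm w ^+ 2 =
    (w 0 0 * v 0 0 + w 0 1 * v 0 1) ^+ 2 + (v 0 0 * w 0 1 - v 0 1 * w 0 0) ^+ 2.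
  by rewrite /N !enorm_sqr; ring.
have tle p q : S p -> S q -> `|t p - t q| <= 2 * d.
  move=> Sp Sq; apply: (le_trans _ (Sclose _ _ Sp Sq)).
  rewrite tB normrM normfV (gtr0_norm N0) ler_pdivrMr//.
  rewrite -(@ler_pXn2r _ 2) ?nnegrE ?mulr_ge0 ?enorm_ge0 ?(ltW N0)//.
  by rewrite [leRHS]exprMn [leRHS]mulrC lagrange real_normK ?num_real// lerDr sqr_ge0.
rewrite (_ : 16 * d = 2 * 2 * (4 * d)); last by ring.
apply: (@hausdorff1_lipschitz _ _ _ t (t p0 - 2 * d)) => //; first lra.
  by move=> p Sp; have := tle _ _ Sp Sp0; rewrite ler_norml => /andP[? ?]; apply/andP; split; lra.
move=> p q Sp Sq; have T := tangent _ _ Sp Sq.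
rewrite -(@ler_pXn2r _ 2) ?nnegrE ?mulr_ge0 ?enorm_ge0//.
rewrite XY Ydiff// enormN exprMn real_normK ?num_real// tB expr_div_n.
rewrite mulrA ler_pdivlMr ?exprn_gt0//.
move: T (lagrange (X p - X q)); set w := X p - X q.
move: (v 0 0 * w 0 1 - _) (w 0 0 * v 0 0 + _) => c s T E.
have s2 : s ^+ 2 <= (N / 2) ^+ 2 * enorm w ^+ 2.
  rewrite -exprMn -[leLHS]real_normK ?num_real//.
  by rewrite ler_pXn2r ?nnegrE// mulr_ge0 ?enorm_ge0// divr_ge0// ltW.
have -> : (enorm w ^+ 2 + enorm w ^+ 2) * N ^+ 2 = 2 * (N ^+ 2 * enorm w ^+ 2) by ring.
move: (sqr_ge0 s) (sqr_ge0 c) s2 E; rewrite expr_div_n mulrAC.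
by move: (N ^+ 2 * _) (c ^+ 2) (s ^+ 2) => Q c2 s2; lra.
Qed.

(** Scale invariance: the mesh is a fixed fraction of [rho], so the number of
    cells depends on [eps] only. *)
Lemma hausdorff1_shell (R : realType) (eps : R) : 0 < eps ->
  exists2 K : R, 0 <= K & forall n (a : mode R) (sx sy : bool)
    (X Y : 'rV[R]_n -> 'rV[R]_2) (rho : R),
  (forall p q, enorm (p - q) ^+ 2 = enorm (X p - X q) ^+ 2 + enorm (Y p - Y q) ^+ 2) ->
  a.2 != 0 ->
  eps <= `|a.2 0 0 / enorm a.2| -> eps <= `| `|a.2 0 0 / enorm a.2| - 1 / 2| ->
  0 < rho ->
  (hausdorff1 (resonant_shell eps a sx sy X Y rho) <= (K * rho)%:E)%E.
Proof.
move=> eps0; pose h := (eps / 20) ^+ 4.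
have h0 : 0 < h by rewrite exprn_gt0// divr_gt0.
(* The mesh 4 * rho / M meets the condition on the cells once 768 / M <= h. *)
pose M := (Num.truncn (768 / h)).+1.
have M0 : 0 < M%:R :> R by rewrite ltr0n.
have Mh : 768 / M%:R <= h.
  rewrite ler_pdivrMr// mulrC -ler_pdivrMr// ltW//.
  have h1 : 0 <= 768 / h by apply: divr_ge0; [exact: ler0n|exact: ltW].
  by have /andP[] := truncn_itv h1.
exists (M.+1%:R * (M.+1%:R * (16 * (4 / M%:R)))) => [|n a sx sy X Y rho XY an ea ea' rho0].
  by rewrite !mulr_ge0// divr_ge0// ltW.
pose d := 4 * rho / M%:R.
have d0 : 0 < d by rewrite divr_gt0// mulr_gt0.
have dM : - (2 * rho) + M%:R * d = 2 * rho by rewrite /d; field; rewrite gt_eqF.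
have -> : M.+1%:R * (M.+1%:R * (16 * (4 / M%:R))) * rho = M.+1%:R * (M.+1%:R * (16 * d)).
  by rewrite /d; ring.
have range p i : resonant_shell eps a sx sy X Y rho p ->
    - (2 * rho) <= X p 0 i <= - (2 * rho) + M%:R * d.
  by move=> [_ _ /andP[_ h4] _ _]; rewrite dM -ler_norml (le_trans (enorm_coord _ _)).
apply: (@hausdorff1_slices _ _ _ (fun p => X p 0 0) (- (2 * rho)) d) => //.
  by move=> p /range.
move=> b0; apply: (@hausdorff1_slices _ _ _ (fun p => X p 0 1) (- (2 * rho)) d) => //.
  by move=> p [/range].
move=> b1; apply: hausdorff1_shell_cell => //.
have -> : 192 * d = rho * (768 / M%:R) by rewrite /d; ring.
by rewrite ler_wpM2l// ltW.
Qed.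

(** * The co-area factor *)

Lemma mx_entry_le_norm (R : realType) m n (A : 'M[R]_(m.+1, n.+1)) i j : `|A i j| <= `|A|.
Proof.
rewrite [leRHS]/Num.norm/= mx_normrE.
exact: (@le_bigmax _ _ _ 0 (fun ij : 'I_m.+1 * 'I_n.+1 => `|A ij.1 ij.2|) (i, j)).
Qed.

Lemma mx_norm_le (R : realType) m n (A : 'M[R]_(m.+1, n.+1)) (c : R) : 0 <= c ->
  (forall i j, `|A i j| <= c) -> `|A| <= c.
Proof.
move=> c0 Ac; rewrite [leLHS]/Num.norm/= mx_normrE.
by apply/bigmax_leP; split => // -[i j] _; exact: Ac.
Qed.

Lemma mulmxr_continuous (R : realType) m n p (M : 'M[R]_(n.+1, p.+1)) :
  continuous (mulmxr M : 'M[R]_(m.+1, n.+1) -> 'M[R]_(m.+1, p.+1)).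
Proof.
apply: (@bounded_linear_continuous _ _ _ (mulmxr M)); apply/linear_boundedP.
exists (n.+1%:R * `|M|); split => [|r Cr w]; first exact: num_real.
apply: (@le_trans _ _ (n.+1%:R * `|M| * `|w|)); last by rewrite ler_wpM2r// ltW.
apply: mx_norm_le => [|i j]; first by rewrite !mulr_ge0.
rewrite mxE; apply: (le_trans (ler_norm_sum _ _ _)).
apply: (@le_trans _ _ (\sum_(k < n.+1) `|M| * `|w|)).
  apply: ler_sum => k _; rewrite normrM mulrC.
  by apply: ler_pM => //; exact: mx_entry_le_norm.
by rewrite sumr_const card_ord -mulrA mulr_natl.
Qed.

(** Row vectors act on the left, so this is the transpose of the usual jacobian
    matrix. *)
Definition constraint_jacobian (R : realType) (sb sg : bool) (p : 'rV[R]_(2 + 2)) :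
    'M[R]_(2 + 2, 1 + 2) :=
  col_mx (row_mx ((-1) ^+ sb *: chord_grad (lsubmx p) (lsubmx p))^T 1%:M)
         (row_mx ((-1) ^+ sg *: chord_grad (rsubmx p) (rsubmx p))^T 1%:M).

(** The identity blocks make the lower right corner of the Gram matrix twice the
    identity, and eliminating it leaves the Schur complement
    [|u| ^ 2 + |v| ^ 2 - |u + v| ^ 2 / 2 = |u - v| ^ 2 / 2]. *)
Lemma det_jacobian_gram (R : realType) (u v : 'rV[R]_2) :
  let M := col_mx (row_mx u^T 1%:M) (row_mx v^T 1%:M) : 'M[R]_(2 + 2, 1 + 2) in
  \det (M^T *m M) = 2 * enorm (u - v) ^+ 2.
Proof.
move=> M; rewrite /M tr_col_mx mul_row_col !tr_row_mx !mul_col_row !trmxK !trmx1.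
rewrite !mul1mx !mulmx1 add_block_mx.
set s := u *m u^T + v *m v^T; set w := u + v.
have -> : block_mx s w (u^T + v^T) (1%:M + 1%:M) =
   block_mx 1%:M (2^-1 *: w) 0 1%:M *m block_mx (s - 2^-1 *: (w *m w^T)) 0 w^T 2%:M.
  rewrite mulmx_block !mul1mx !mul0mx !add0r -scalemxAl subrK.
  rewrite mul_mx_scalar scalerA mulfV// scale1r /w linearD/=.
  by congr block_mx; rewrite -raddfD.
rewrite det_mulmx det_ublock !det1 !mul1r det_lblock det_scalar det_mx11.
rewrite enorm_sqr /s /w !mxE !sum_ord2 !mxE.
by field.
Qed.

(** The secant formula, with the secant gradient compared to the gradient. *)
Lemma cos_taylor (R : realType) (rho t : R) (k l : 'rV[R]_2) :
  0 < rho -> 2 * t <= rho -> 2 * rho <= enorm l -> (forall i, `|k 0 i| <= t) ->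
  `|(k + l) 0 0 / enorm (k + l) - l 0 0 / enorm l
    - (k 0 0 * chord_grad l l 0 0 + k 0 1 * chord_grad l l 0 1)| <=
  24 * t / rho ^+ 2 * t.
Proof.
move=> rho0 trho lr kt.
have kt2 : enorm k <= 2 * t.
  by apply: (le_trans (enorm_le_sum _)); have := kt 0; have := kt 1; lra.
have klr : rho <= enorm (k + l).
  by have := enorm_dist (k + l) l; rewrite addrK ler_norml => /andP[? _]; lra.
have lr1 : rho <= enorm l by lra.
have ln : l != 0 by apply: enorm_gt0_neq0; lra.
have kln : k + l != 0 by apply: enorm_gt0_neq0; lra.
have t0 : 0 <= t by rewrite (le_trans _ (kt 0)).
rewrite (chord_gradP kln ln) addrK.
have d1 : enorm (k + l - l) <= 2 * t by rewrite addrK.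
have d2 : enorm (l - l) <= 2 * t by rewrite subrr enorm0 mulr_ge0.
have g i := chord_grad_near i rho0 klr lr1 lr1 d1 d2.
set A := chord_grad (k + l) l in g *; set B := chord_grad l l in g *.
have -> : k 0 0 * A 0 0 + k 0 1 * A 0 1 - (k 0 0 * B 0 0 + k 0 1 * B 0 1) =
  k 0 0 * (A 0 0 - B 0 0) + k 0 1 * (A 0 1 - B 0 1) by ring.
apply: (le_trans (ler_normD _ _)); rewrite !normrM.
have -> : 24 * t / rho ^+ 2 * t =
  t * (6 * (2 * t) / rho ^+ 2) + t * (6 * (2 * t) / rho ^+ 2) by ring.
by apply: lerD; apply: ler_pM.
Qed.

Lemma jacobian_constraintE (R : realType) (a : mode R) (sb sg : bool) (p : 'rV[R]_(2 + 2)) :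
  lsubmx p != 0 -> rsubmx p != 0 ->
  'J (constraint a sb sg) p = constraint_jacobian sb sg p.
Proof.
set x := lsubmx p; set y := rsubmx p => xn yn.
set M := constraint_jacobian sb sg p.
have diffE : 'd (constraint a sb sg) p = mulmxr M :> ('rV[R]_(2 + 2) -> 'rV[R]_(1 + 2)).
  apply: diff_unique; first exact: mulmxr_continuous.
  (* Within distance rho of p neither half of the point vanishes. *)
  pose rho := Num.min (enorm x) (enorm y) / 2.
  have rho0 : 0 < rho by rewrite divr_gt0// lt_min !enorm_gt0.
  have rx : 2 * rho <= enorm x by rewrite /rho mulrC divfK// ge_min lexx.
  have ry : 2 * rho <= enorm y by rewrite /rho mulrC divfK// ge_min lexx orbT.
  have near0 (c : R) : 0 < c -> \forall w \near (0 : 'rV[R]_(2 + 2)), `|w| <= c.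
    by move=> c0; apply/nbhs_norm0P; exists c => // w /= /ltW.
  apply/eqaddoP => e e0; near=> w.
  have wrho : 2 * `|w| <= rho.
    rewrite mulrC -ler_pdivlMr//; near: w; apply: near0; exact: divr_gt0.
  have we : 48 * `|w| / rho ^+ 2 <= e.
    rewrite ler_pdivrMr ?exprn_gt0// mulrC -ler_pdivlMr//; near: w; apply: near0.
    by rewrite divr_gt0// mulr_gt0// exprn_gt0.
  set u := lsubmx w; set v := rsubmx w.
  have uw i : `|u 0 i| <= `|w| by rewrite mxE mx_entry_le_norm.
  have vw i : `|v 0 i| <= `|w| by rewrite mxE mx_entry_le_norm.
  apply: (@le_trans _ _ (48 * `|w| / rho ^+ 2 * `|w|)); last by rewrite /= ler_wpM2r.
  apply: mx_norm_le => [|i j].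
    by rewrite !mulr_ge0 ?invr_ge0 ?exprn_ge0// ltW.
  rewrite ord1 [X in `|X|](_ : _ = constraint a sb sg (w + p) 0 j -
    (constraint a sb sg p 0 j + (w *m M) 0 j)); last by rewrite !mxE.
  have wM : w *m M = row_mx (u *m ((-1) ^+ sb *: chord_grad x x)^T +
      v *m ((-1) ^+ sg *: chord_grad y y)^T) (u + v).
    by rewrite -[w in LHS]hsubmxK mul_row_col !mul_mx_row !mulmx1 add_row_mx.
  have xw : lsubmx (w + p) = u + x by rewrite linearD.
  have yw : rsubmx (w + p) = v + y by rewrite linearD.
  rewrite wM /constraint xw yw -/x -/y; case: (@split_ordP 1 2 j) => k -> {j}; last first.
    rewrite !row_mxEr !mxE (_ : _ - _ = 0) ?normr0; last by ring.
    by rewrite !mulr_ge0 ?invr_ge0 ?exprn_ge0// ltW.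
  have add11 (A B : 'M[R]_1) : (A + B) 0 0 = A 0 0 + B 0 0 by rewrite mxE.
  have scalar11 (c : R) : (c%:M : 'M[R]_1) 0 0 = c by rewrite mxE.
  have dot11 (q l : 'rV[R]_2) (s : R) :
      (q *m (s *: l)^T) 0 0 = s * (q 0 0 * l 0 0 + q 0 1 * l 0 1).
    by rewrite mxE sum_ord2 !mxE; ring.
  rewrite !row_mxEl ord1 add11 !scalar11 !dot11 /omega /sign /= -!(mulrA ((-1) ^+ _)).
  move: (cos_taylor rho0 wrho rx uw) (cos_taylor rho0 wrho ry vw).
  move: ((u + x) 0 0 / _) (x 0 0 / _) (_ + _ * chord_grad x x 0 1) => ux cx gx.
  move: ((v + y) 0 0 / _) (y 0 0 / _) (_ + _ * chord_grad y y 0 1) => vy cy gy.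
  move=> hx hy.
  rewrite [X in `|X|](_ : _ = (-1) ^+ sb * (ux - cx - gx) + (-1) ^+ sg * (vy - cy - gy));
    last by ring.
  have -> : 48 * `|w| / rho ^+ 2 * `|w| =
    24 * `|w| / rho ^+ 2 * `|w| + 24 * `|w| / rho ^+ 2 * `|w| by ring.
  by apply: (le_trans (ler_normD _ _)); rewrite !norm_signMl; apply: lerD.
apply/row_matrixP => i; rewrite !rowE /jacobian mul_rV_lin1.
by rewrite diffE.
Unshelve. all: by end_near.
Qed.

Lemma coarea_factorE (R : realType) (a : mode R) (sb sg : bool) (p : 'rV[R]_(2 + 2)) :
  lsubmx p != 0 -> rsubmx p != 0 ->
  coarea_factor a sb sg p =
  Num.sqrt 2 * enorm (phase_grad sb sg (lsubmx p) (rsubmx p)).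
Proof.
move=> xn yn; rewrite /coarea_factor jacobian_constraintE// trmxK det_jacobian_gram.
by rewrite sqrtrM// sqrtr_sqr ger0_norm ?enorm_ge0.
Qed.

(** * Measurability of the shells and domination of integrals *)

Lemma closed_eq0_continuous (R : realType) (T : topologicalType) (g : T -> R) :
  continuous g -> closed [set p | g p = 0].
Proof.
by move=> gc; apply: (@closed_comp _ _ g [set x | x = 0]) => [p _|]; [exact: gc|exact: closed_eq].
Qed.

Lemma closed_le_continuous (R : realType) (T : topologicalType) (f g : T -> R) :
  continuous f -> continuous g -> closed [set p | f p <= g p].
Proof.
move=> fc gc; have -> : [set p | f p <= g p] = (g \- f) @^-1` [set x | 0 <= x].
  by apply/seteqP; split => p /=; rewrite subr_ge0.
apply: closed_comp => [p _|]; last exact: closed_ge.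
by apply: (@continuousB _ R^o); [exact: gc|exact: fc].
Qed.

(** Continuity is asked coordinatewise, the form in which it is available for the
    halves of a point. *)
Lemma enorm_continuous (R : realType) (T : topologicalType) (X : T -> 'rV[R]_2) :
  (forall i, continuous (fun p => X p 0 i)) -> continuous (fun p => enorm (X p)).
Proof.
move=> Xc; rewrite (_ : (fun p => _) =
    Num.sqrt \o ((fun p => X p 0 0 * X p 0 0) \+ (fun p => X p 0 1 * X p 0 1))); last first.
  by apply/funext => p; rewrite /= enormE !expr2.
move=> p; apply: continuous_comp; last exact: sqrt_continuous.
by apply: (@continuousD _ R^o); apply: continuousM; exact: Xc.
Qed.

Lemma closed_measurable_borel (R : realType) n (S : set 'rV[R]_n) :
  closed S -> measurable (S : set (borel_rV R n)).
Proof.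
move=> Sc; rewrite -[S]setCK; apply: measurableC; apply: sub_sigma_algebra.
exact: closed_openC.
Qed.

Lemma measurable_resonant_shell (R : realType) n (eps : R) (a : mode R) (sx sy : bool)
    (X Y : 'rV[R]_n -> 'rV[R]_2) (rho : R) :
  (forall i, continuous (fun p => X p 0 i)) -> (forall i, continuous (fun p => Y p 0 i)) ->
  measurable (resonant_shell eps a sx sy X Y rho : set (borel_rV R n)).
Proof.
move=> Xc Yc; apply: closed_measurable_borel.
have Xn := enorm_continuous Xc; have Yn := enorm_continuous Yc.
have cst_c (c : R) : continuous (fun _ : 'rV[R]_n => c) by apply: cst_continuous.
pose x0 p := X p 0 0; pose y0 p := Y p 0 0.
pose nx p := enorm (X p); pose ny p := enorm (Y p).
pose sum i := (fun=> a.2 0 i) \+ (fun p => X p 0 i) \+ (fun p => Y p 0 i).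
pose res := (fun=> omega a) \* (nx \* ny) \+ (fun=> (-1) ^+ sx) \* x0 \* ny
  \+ (fun=> (-1) ^+ sy) \* y0 \* nx.
have -> : resonant_shell eps a sx sy X Y rho =
    [set p | sum 0 p = 0] `&` [set p | sum 1 p = 0] `&` [set p | res p = 0]
    `&` [set p | rho <= enorm (X p)] `&` [set p | enorm (X p) <= 2 * rho]
    `&` [set p | enorm (X p) <= enorm (Y p)] `&` [set p | eps * enorm (X p) <= `|X p 0 0|].
  apply/seteqP; split => p /=.
    move=> [h1 h2 /andP[h3 h4] h5 h6]; do ![split] => //.
    - by move/rowP/(_ 0): h1; rewrite !mxE.
    - by move/rowP/(_ 1): h1; rewrite !mxE.
  move=> [[[[[[s0 s1] h2] h3] h4] h5] h6]; split => //; last by rewrite h3 h4.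
  by apply/rowP; apply: ord2P; rewrite !mxE.
have sumc i : continuous (sum i).
  move=> p; apply: (@continuousD _ R^o); last exact: Yc.
  by apply: (@continuousD _ R^o); [exact: cst_c|exact: Xc].
have resc : continuous res.
  move=> p; apply: (@continuousD _ R^o); first apply: (@continuousD _ R^o).
  - by apply: continuousM; [exact: cst_c|apply: continuousM; [exact: Xn|exact: Yn]].
  - by apply: continuousM; [apply: continuousM; [exact: cst_c|exact: Xc]|exact: Yn].
  - by apply: continuousM; [apply: continuousM; [exact: cst_c|exact: Yc]|exact: Xn].
do ![apply: closedI].
- exact: closed_eq0_continuous.
- exact: closed_eq0_continuous.
- exact: closed_eq0_continuous.
- exact: closed_le_continuous.
- exact: closed_le_continuous.
- exact: closed_le_continuous.
- apply: (@closed_le_continuous _ _ ((fun=> eps) \* nx)) => p.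
    by apply: continuousM; [exact: cst_c|exact: Xn].
  apply: (@continuous_comp _ _ _ (fun p => X p 0 0) Num.norm); first exact: Xc.
  exact: (@norm_continuous _ R^o).
Qed.

Local Open Scope ereal_scope.

(** The integral of a nonnegative function is the supremum of the integrals of
    the simple functions below it; domination therefore passes to the integrals of
    the positive and the negative part for an arbitrary integrand, and likewise
    for an arbitrary domain. *)
Lemma abs_integral_le_dominated d (T : measurableType d) (R : realType)
    (mu : {measure set T -> \bar R}) (D : set T) (f h : T -> \bar R) :
  (forall x, 0 <= h x) -> (forall x, D x -> `|f x| <= h x) ->
  `|\int[mu]_(x in D) f x| <= \int[mu]_x h x.
Proof.
move=> h0 fh.
have part (g : T -> \bar R) : (forall x, D x -> 0 <= g x <= h x) ->
    0 <= \int[mu]_(x in D) g x <= \int[mu]_x h x.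
  move=> gh; have g0 x : D x -> 0 <= g x by move=> /gh/andP[].
  rewrite integral_ge0//= !ge0_integralE//; apply: le_ereal_sup => _ [u uf <-].
  exists u => // x; apply: (le_trans (uf x)); rewrite patch_setT /patch.
  by case: ifPn => // /set_mem/gh/andP[].
rewrite integralE.
have /part/andP[] : forall x, D x -> 0 <= f^\+ x <= h x.
  move=> x Dx; rewrite funeposE le_max lexx orbT/= ge_max h0 andbT.
  exact: le_trans (lee_abs _) (fh _ Dx).
have /part/andP[] : forall x, D x -> 0 <= f^\- x <= h x.
  move=> x Dx; rewrite funenegE le_max lexx orbT/= ge_max h0 andbT.
  by apply: (le_trans (lee_abs _)); rewrite abseN; exact: fh.
move: (\int[mu]_(x in D) f^\- x) (\int[mu]_(x in D) f^\+ x) (\int[mu]_x h x).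
move=> u v [M| |] u0 uM v0 vM; [|by rewrite leey|by have := le_trans u0 uM].
case: u u0 uM => [u| |] //; case: v v0 vM => [v| |] //; rewrite !lee_fin => *.
by rewrite ler_norml; apply/andP; split; lra.
Qed.

(** The dominating function is the sum of the [c b i] times the indicators of the
    [E b i]. *)
Lemma abs_integral_le_cover d (T : measurableType d) (R : realType)
    (mu : {measure set T -> \bar R}) (I : finType) (D : set T) (f : T -> \bar R)
    (E : I -> nat -> set T) (c : I -> nat -> R) :
  (forall b i, measurable (E b i)) -> (forall b i, (0 <= c b i)%R) ->
  (forall x, D x -> f x != 0 -> exists b i, E b i x /\ `|f x| <= (c b i)%:E) ->
  `|\int[mu]_(x in D) f x| <= \sum_(b : I) \sum_(i <oo) (c b i)%:E * mu (E b i).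
Proof.
move=> mE c0 cover.
pose g b i x := (c b i)%:E * (\1_(E b i) x)%:E.
have g0 b i x : 0 <= g b i x by rewrite mule_ge0 ?lee_fin.
have mg b i : measurable_fun [set: T] (g b i : T -> \bar R).
  by apply: measurable_funeM; apply/measurable_EFinP; exact: measurable_indic.
have s0 b x : 0 <= \sum_(i <oo) g b i x by apply: nneseries_ge0 => *.
apply: (@le_trans _ _ (\int[mu]_x \sum_(b : I) \sum_(i <oo) g b i x)).
  apply: abs_integral_le_dominated => [x|x Dx]; first by apply: sume_ge0 => *; exact: s0.
  have [->|fx0] := eqVneq (f x) 0; first by rewrite abse0 sume_ge0// => *; exact: s0.
  have [b [i [Ex fc]]] := cover _ Dx fx0.
  rewrite (bigD1 b)//= (@nneseriesD1 _ _ i)//.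
  rewrite /g indicE mem_set// mule1 -addeA -[leLHS]adde0 leeD// adde_ge0//.
    by apply: nneseries_ge0 => *; exact: g0.
  by apply: sume_ge0 => *; exact: s0.
rewrite ge0_integral_sum//; last first.
  by move=> b; apply: ge0_emeasurable_sum => *.
apply: lee_sum => b _; rewrite integral_nneseries//.
apply: lee_nneseries => i _; first by move=> _; apply: integral_ge0.
by rewrite ge0_integralZl ?lee_fin// ?integral_indic ?setIT//;
  by apply/measurable_EFinP; exact: measurable_indic.
Qed.

Lemma nneseries_geometric_le (R : realType) (u : nat -> \bar R) (A q : R) :
  (0 <= A)%R -> (0 <= q < 1)%R -> (forall i, 0 <= u i <= (A * q ^+ i)%:E) ->
  \sum_(i <oo) u i <= (A / (1 - q))%:E.
Proof.
move=> A0 /andP[q0 q1] uA.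
have u0 i : 0 <= u i by have /andP[] := uA i.
apply: lime_le; first by apply: is_cvg_nneseries => *.
apply: nearW => n; apply: (@le_trans _ _ (\sum_(0 <= i < n) (A * q ^+ i)%:E)).
  by apply: lee_sum => i _; have /andP[] := uA i.
have q1' : (0 < 1 - q)%R by rewrite subr_gt0.
rewrite sumEFin lee_fin ler_pdivlMr//.
have -> : ((\sum_(0 <= i < n) (A * q ^+ i)) * (1 - q) = A * (1 - q ^+ n))%R.
  elim: n => [|n IH]; first by rewrite big_nil expr0 subrr mul0r mulr0.
  by rewrite big_nat_recr//= mulrDl IH exprS; ring.
by rewrite ler_piMr// gerBl exprn_ge0.
Qed.

Local Close Scope ereal_scope.

(** * Pointwise bound of the collision integrand *)

Lemma cutoff_support (R : realType) (eps : R) chi (k : 'rV[R]_2) :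
  is_cutoff eps chi -> k != 0 -> chi (angle k) != 0 ->
  eps <= `|k 0 0 / enorm k| /\ eps <= `| `|k 0 0 / enorm k| - 1 / 2|.
Proof.
move=> [_ _ _ _ [chi0 _]] /enorm_gt0 k0 chik.
have -> : k 0 0 / enorm k = cos (angle k).
  by have [{1}-> _] := angleP k; rewrite mulrC mulKf// gt_eqF.
by split; rewrite leNgt; apply: contraNN chik => hk; apply/eqP/chi0; [left|right].
Qed.

(** With opposite signs the norms of [a.2] and [y] cancel up to [|x|].  With equal
    signs the resonance reads [|cos x| = |cos a + cos y|], and the right side is at
    most [2 |x| / |y|] because [a.2] and [- y] differ by [x]; the lower
    bound on [|cos x|] then bounds [|y|] by a multiple of [|x|]. *)
Lemma resonant_norm_sum_le (R : realType) (eps : R) (a : mode R) (sx sy : bool)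
    (x y : 'rV[R]_2) :
  0 < eps -> a.2 != 0 -> x != 0 -> y != 0 -> a.2 + x + y = 0 ->
  omega a + omega (sx, x) + omega (sy, y) = 0 ->
  eps <= `|x 0 0 / enorm x| ->
  `|sign a * enorm a.2 + (-1) ^+ sx * enorm x + (-1) ^+ sy * enorm y| <=
  (2 + 4 / eps) * enorm x.
Proof.
move=> eps0 /enorm_gt0 a0 /enorm_gt0 x0 /enorm_gt0 y0 sum0 res ex.
have aE : a.2 + y = - x by apply/eqP; rewrite -addr_eq0 addrAC sum0.
have ay : `|enorm a.2 - enorm y| <= enorm x.
  by rewrite -(enormN y) (le_trans (enorm_dist _ _))// opprK aE enormN.
have e4 : 0 <= 4 / eps * enorm x.
  by rewrite !mulr_ge0 ?invr_ge0 ?enorm_ge0 ?(ltW eps0).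
rewrite mulrDl /sign; have [say|say] := eqVneq a.1 sy; last first.
  have opp (u v : bool) : u != v -> (-1) ^+ u = - (-1) ^+ v :> R.
    by case: u; case: v => //= _; rewrite ?expr1 ?expr0 ?opprK.
  rewrite (opp _ _ say).
  have -> : - (-1) ^+ sy * enorm a.2 + (-1) ^+ sx * enorm x + (-1) ^+ sy * enorm y =
      (-1) ^+ sx * enorm x - (-1) ^+ sy * (enorm a.2 - enorm y) by ring.
  apply: (le_trans (ler_normB _ _)); rewrite !norm_signMl (ger0_norm (enorm_ge0 x)).
  by lra.
have cosE : `|a.2 0 0 / enorm a.2 + y 0 0 / enorm y| = `|x 0 0 / enorm x|.
  rewrite -[LHS](norm_signMl sy) -[RHS](norm_signMl sx) -[RHS]normrN; congr (`|_|).
  move: res; rewrite /omega /sign /= say -!mulrA.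
  by lra.
have near : `|a.2 0 0 / enorm a.2 + y 0 0 / enorm y| * enorm y <= 2 * enorm x.
  have -> : `|a.2 0 0 / enorm a.2 + y 0 0 / enorm y| * enorm y =
      `|- x 0 0 - a.2 0 0 / enorm a.2 * (enorm a.2 - enorm y)|.
    rewrite -{2}(gtr0_norm y0) -normrM; congr (`|_|).
    have -> : - x 0 0 = a.2 0 0 + y 0 0 by move/rowP/(_ 0): aE; rewrite !mxE => <-.
    by field; rewrite !gt_eqF.
  apply: (le_trans (ler_normB _ _)); rewrite normrN normrM.
  have : `|a.2 0 0 / enorm a.2| * `|enorm a.2 - enorm y| <= 1 * enorm x.
    apply: ler_pM => //.
    by rewrite normrM normfV (gtr0_norm a0) ler_pdivrMr// mul1r enorm_coord.
  have := enorm_coord x 0; lra.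
have yx : enorm y <= 2 / eps * enorm x.
  rewrite mulrAC ler_pdivlMr// mulrC (le_trans _ near)// ler_wpM2r ?enorm_ge0//.
  by rewrite cosE.
apply: (le_trans (ler_normD _ _)); rewrite norm_signMl (ger0_norm (enorm_ge0 y)).
apply: (@le_trans _ _ (enorm a.2 + enorm x + enorm y)).
  rewrite lerD2r (le_trans (ler_normD _ _))// !norm_signMl.
  by rewrite !ger0_norm ?enorm_ge0.
have : enorm a.2 <= enorm x + enorm y by move: ay; rewrite ler_norml => /andP[? ?]; lra.
have -> : 4 / eps * enorm x = 2 * (2 / eps * enorm x) by ring.
by lra.
Qed.

Lemma sin_angle_le1 (R : realType) (s : bool) (t : R) : `|(-1) ^+ s * sin t| <= 1.
Proof. by rewrite norm_signMl ler_norml sin_geN1 sin_le1. Qed.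

Lemma Gamma_le (R : realType) (a b g : mode R) :
  `|Gamma a b g| <= 3 * pi ^+ 2 *
    `|sign a * enorm a.2 + sign b * enorm b.2 + sign g * enorm g.2|.
Proof.
rewrite /Gamma normrM ler_wpM2r// normrM mulrC normrX (ger0_norm (pi_ge0 R)).
rewrite ler_wpM2r ?exprn_ge0 ?pi_ge0//.
have -> : 3 = 1 + 1 + 1 :> R by lra.
apply: (le_trans (ler_normD _ _)); apply: lerD; last exact: sin_angle_le1.
by apply: (le_trans (ler_normD _ _)); apply: lerD; exact: sin_angle_le1.
Qed.

(** The symmetry that allows the shorter of the two wave vectors to come first. *)
Lemma collision_integrandC (R : realType) (chi : R -> R) n (a b g : mode R) :
  collision_integrand chi n a b g = collision_integrand chi n a g b.
Proof. by rewrite /collision_integrand /Gamma; ring. Qed.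

Lemma omega_le1 (R : realType) (a : mode R) : `|omega a| <= 1.
Proof.
rewrite /omega /sign -mulrA norm_signMl normrM.
have [->|a0] := eqVneq a.2 0; first by rewrite mxE normr0 mul0r.
by rewrite normfV (gtr0_norm (enorm_gt0 a0)) ler_pdivrMr ?enorm_gt0// mul1r enorm_coord.
Qed.

Definition decay (R : realType) (m : R) (k : 'rV[R]_2) : R := (bracket k `^ m)^-1.

Lemma bracket_ge1 (R : realType) (k : 'rV[R]_2) : 1 <= bracket k.
Proof.
by rewrite /bracket -[leLHS]sqrtr1 ler_wsqrtr// lerDl sqr_ge0.
Qed.

Lemma bracket_gt0 (R : realType) (k : 'rV[R]_2) : 0 < bracket k.
Proof. exact: lt_le_trans (bracket_ge1 k). Qed.

Lemma enorm_le_bracket (R : realType) (k : 'rV[R]_2) : enorm k <= bracket k.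
Proof.
rewrite /bracket -[leLHS]ger0_norm ?enorm_ge0// -sqrtr_sqr ler_wsqrtr//.
by rewrite lerDr.
Qed.

Lemma bracket_sqr (R : realType) (k : 'rV[R]_2) : bracket k ^+ 2 = 1 + enorm k ^+ 2.
Proof. by apply: sqr_sqrtr; rewrite addr_ge0 ?sqr_ge0. Qed.

Lemma bracket_le (R : realType) (c : R) (k l : 'rV[R]_2) : 1 <= c ->
  enorm k <= c * enorm l -> bracket k <= c * bracket l.
Proof.
move=> c1 kl; have c0 : 0 <= c by lra.
rewrite -(@ler_pXn2r _ 2) ?nnegrE ?mulr_ge0// ?(ltW (bracket_gt0 _))//.
rewrite exprMn !bracket_sqr mulrDr mulr1; apply: lerD.
  by rewrite expr_ge1.
by rewrite -exprMn ler_pXn2r ?nnegrE ?mulr_ge0 ?enorm_ge0.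
Qed.

Lemma decay_gt0 (R : realType) (m : R) (k : 'rV[R]_2) : 0 < decay m k.
Proof. by rewrite invr_gt0 powR_gt0// bracket_gt0. Qed.

Lemma decay_le (R : realType) (m c : R) (k : 'rV[R]_2) : 0 <= m -> 0 < c ->
  c <= bracket k -> decay m k <= (c `^ m)^-1.
Proof.
move=> m0 c0 ck; rewrite lef_pV2 ?posrE ?powR_gt0 ?bracket_gt0//.
by rewrite ge0_ler_powR// nnegrE ltW ?bracket_gt0.
Qed.

(** The weight of a wave vector is controlled by that of any wave vector
    at most [c] times longer. *)
Lemma decay_comp (R : realType) (m c : R) (k l : 'rV[R]_2) : 0 <= m -> 1 <= c ->
  enorm k <= c * enorm l -> decay m l <= c `^ m * decay m k.
Proof.
move=> m0 c1 kl; have c0 : 0 < c by lra.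
have b0 := bracket_gt0 k; have l0 := bracket_gt0 l.
rewrite /decay mulrC ler_pdivlMl ?powR_gt0// -ler_pdivlMr ?invr_gt0 ?powR_gt0// invrK.
rewrite -powRM; [|exact: ltW|exact: ltW].
apply: ge0_ler_powR => //; [by rewrite nnegrE ltW|by rewrite nnegrE ltW// mulr_gt0|].
exact: bracket_le.
Qed.

Lemma decay_anti (R : realType) (m : R) (k l : 'rV[R]_2) : 0 <= m ->
  enorm k <= enorm l -> decay m l <= decay m k.
Proof.
move=> m0 kl; have p1 : 1 `^ m = 1 :> R by rewrite powR1.
rewrite -[leRHS]mul1r -[X in X * _]p1; apply: decay_comp => //.
by rewrite mul1r.
Qed.

(** [A], [X], [Y] stand for the decay weights of the three modes, [Y] being that of
    the longest wave vector: in each product, [Y] is replaced by [X] or by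
    [P * A] so that one weight of each kind remains. *)
Lemma cubic_terms_le (R : realFieldType) (N A X Y P na nx ny wa wx wy : R) :
  0 <= na -> na <= N * A -> 0 <= nx -> nx <= N * X -> 0 <= ny -> ny <= N * Y ->
  0 <= A -> 0 <= X -> Y <= X -> Y <= P * A ->
  `|wa| <= 1 -> `|wx| <= 1 -> `|wy| <= 1 ->
  `|wa * nx * ny + wy * na * nx + wx * na * ny| <= (2 + P) * N ^+ 2 * A * X.
Proof.
move=> na0 naN nx0 nxN ny0 nyN A0 X0 YX YA wa1 wx1 wy1.
have pair u v U V : 0 <= u -> u <= N * U -> 0 <= v -> v <= N * V ->
    u * v <= N ^+ 2 * (U * V).
  move=> u0 uU v0 vV; have -> : N ^+ 2 * (U * V) = N * U * (N * V) by ring.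
  exact: ler_pM.
have term w u v U V : `|w| <= 1 -> 0 <= u -> u <= N * U -> 0 <= v -> v <= N * V ->
    `|w * u * v| <= N ^+ 2 * (U * V).
  move=> w1 u0 uU v0 vV; rewrite -mulrA normrM -[leRHS]mul1r ler_pM//.
  by rewrite ger0_norm ?pair// mulr_ge0.
have N20 := sqr_ge0 N.
have -> : (2 + P) * N ^+ 2 * A * X =
  N ^+ 2 * (X * (P * A)) + N ^+ 2 * (A * X) + N ^+ 2 * (A * X) by ring.
apply: (le_trans (ler_normD _ _)); apply: lerD.
  apply: (le_trans (ler_normD _ _)); apply: lerD; last exact: term.
  apply: (le_trans (term _ _ _ X Y _ _ _ _ _)) => //.
  by rewrite ler_wpM2l// ler_wpM2l.
apply: (le_trans (term _ _ _ A Y _ _ _ _ _)) => //.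
by rewrite ler_wpM2l// ler_wpM2l.
Qed.

Lemma integrand_factors_le (R : realFieldType) (w c1 c2 c3 G T S K r : R) :
  `|w| <= 1 -> `|c1| <= 1 -> `|c2| <= 1 -> `|c3| <= 1 -> G ^+ 2 <= K * r ->
  `|T| <= S -> `|G ^+ 2 * w * c1 * c2 * c3 * T| <= K * S * r.
Proof.
move=> hw h1 h2 h3 hG hT.
have -> : K * S * r = K * r * 1 * 1 * 1 * 1 * S by ring.
rewrite normrM; apply: ler_pM => //.
do 4 (rewrite normrM; apply: ler_pM => //).
by rewrite ger0_norm// sqr_ge0.
Qed.

Lemma collision_integrand_le (R : realType) (eps m N : R) (chi : R -> R) (n : mode R -> R)
    (a : mode R) (sx sy : bool) (x y : 'rV[R]_2) :
  0 < eps -> 0 <= m -> (forall t, 0 <= chi t <= 1) ->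
  (forall b, 0 <= n b) -> (forall b, n b <= N * decay m b.2) ->
  a.2 != 0 -> x != 0 -> y != 0 -> a.2 + x + y = 0 ->
  omega a + omega (sx, x) + omega (sy, y) = 0 ->
  eps <= `|x 0 0 / enorm x| -> enorm x <= enorm y ->
  `|collision_integrand chi n a (sx, x) (sy, y)| <=
    (3 * pi ^+ 2 * (2 + 4 / eps)) ^+ 2 *
    ((2 + 2 `^ m) * N ^+ 2 * decay m a.2 * decay m x) * enorm x ^+ 2.
Proof.
move=> eps0 m0 chi01 n0 nN an xn yn sum0 res ex xy.
have N0 : 0 <= N by rewrite -(pmulr_lge0 _ (decay_gt0 m a.2)) (le_trans (n0 a)).
set b := (sx, x); set g := (sy, y).
have G2 : Gamma a b g ^+ 2 <= (3 * pi ^+ 2 * (2 + 4 / eps)) ^+ 2 * enorm x ^+ 2.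
  rewrite -exprMn -[leLHS]real_normK ?num_real//.
  rewrite ler_pXn2r ?nnegrE//; last first.
    apply: mulr_ge0; last exact: enorm_ge0.
    apply: mulr_ge0; first by rewrite mulr_ge0 ?exprn_ge0 ?pi_ge0.
    by rewrite addr_ge0// divr_ge0// ltW.
  rewrite (le_trans (Gamma_le _ _ _))// -[leRHS]mulrA ler_wpM2l//.
    by rewrite mulr_ge0 ?exprn_ge0 ?pi_ge0.
  exact: resonant_norm_sum_le sum0 res ex.
have da := decay_gt0 m a.2; have dx := decay_gt0 m x; have dy := decay_gt0 m y.
have yx : decay m y <= decay m x by exact: decay_anti.
have ya : decay m y <= 2 `^ m * decay m a.2.
  apply: decay_comp; [exact: m0|by rewrite ler1n|].
  have -> : a.2 = - (x + y) by apply/eqP; rewrite -addr_eq0 addrA sum0.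
  by rewrite enormN mulrDl mul1r (le_trans (enormD _ _))// lerD2r.
have S : `|omega a * n b * n g + omega g * n a * n b + omega b * n a * n g| <=
    (2 + 2 `^ m) * N ^+ 2 * decay m a.2 * decay m x.
  exact: (cubic_terms_le (n0 a) (nN a) (n0 b) (nN b) (n0 g) (nN g) (ltW da) (ltW dx)
    yx ya (omega_le1 a) (omega_le1 b) (omega_le1 g)).
have unit1 t : `|chi t| <= 1 by have /andP[c0 c1] := chi01 t; rewrite ger0_norm.
exact: (integrand_factors_le (omega_le1 a) (unit1 (angle a.2)) (unit1 (angle b.2))
  (unit1 (angle g.2)) G2 S).
Qed.

Lemma quotient_scalar_le (R : realFieldType) (I J h K P r s v : R) :
  0 < h -> 0 < r -> 1 <= s -> h <= r * v -> J = s * v -> `|I| <= K * P * r ^+ 2 ->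
  `|I / J| <= K / h * P * r ^+ 3.
Proof.
move=> h0 r0 s1 hv -> IK.
have v0 : 0 < v by rewrite -(pmulr_rgt0 _ r0) (lt_le_trans h0).
have s0 : 0 < s by rewrite (lt_le_trans ltr01).
rewrite normrM normfV (gtr0_norm (mulr_gt0 s0 v0)).
have -> : K / h * P * r ^+ 3 = K * P * r ^+ 2 * (r / h) by ring.
apply: ler_pM => //; first by rewrite invr_ge0 ltW ?mulr_gt0.
rewrite -[leRHS]invrK invf_div lef_pV2 ?posrE ?mulr_gt0 ?invr_gt0//.
rewrite ler_pdivrMr// (le_trans hv)// mulrC ler_wpM2r ?(ltW r0)//.
by apply: ler_peMl => //; exact: ltW.
Qed.

(** [|Gamma| ^ 2] gives two powers of [|x|] and the inverse of the co-area
    factor a third one. *)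
Lemma collision_quotient_le (R : realType) (eps m : R) : 0 < eps -> 0 <= m ->
  exists2 B : R, 0 <= B & forall (N : R) (chi : R -> R) (n : mode R -> R)
    (a : mode R) (sx sy : bool) (x y : 'rV[R]_2),
  (forall t, 0 <= chi t <= 1) ->
  (forall b, 0 <= n b) -> (forall b, n b <= N * decay m b.2) ->
  a.2 != 0 -> x != 0 -> y != 0 -> a.2 + x + y = 0 ->
  omega a + omega (sx, x) + omega (sy, y) = 0 ->
  eps <= `|a.2 0 0 / enorm a.2| -> eps <= `| `|a.2 0 0 / enorm a.2| - 1 / 2| ->
  eps <= `|x 0 0 / enorm x| -> enorm x <= enorm y ->
  `|collision_integrand chi n a (sx, x) (sy, y)
    / (Num.sqrt 2 * enorm (phase_grad sx sy x y))| <=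
  B * N ^+ 2 * decay m a.2 * (decay m x * enorm x ^+ 3).
Proof.
move=> eps0 m0.
have h0 : 0 < (eps / 20) ^+ 4 by rewrite exprn_gt0// divr_gt0.
exists ((3 * pi ^+ 2 * (2 + 4 / eps)) ^+ 2 * (2 + 2 `^ m) / (eps / 20) ^+ 4).
  apply: divr_ge0; last exact: ltW.
  by apply: mulr_ge0; [exact: sqr_ge0|rewrite addr_ge0// powR_ge0].
move=> N chi n a sx sy x y chi01 n0 nN an xn yn sum0 res ea ea' ex xy.
have I_le := collision_integrand_le eps0 m0 chi01 n0 nN an xn yn sum0 res ex xy.
have gap := phase_grad_ge eps0 an xn yn sum0 res ea ea' ex.
have s1 : 1 <= Num.sqrt 2 :> R by rewrite -[leLHS]sqrtr1 ler_wsqrtr// ler1n.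
apply: (le_trans (quotient_scalar_le h0 (enorm_gt0 xn) s1 gap erefl I_le)).
move: (enorm x) (decay m x) (decay m a.2) ((_ * (2 + _)) ^+ 2) (_ ^+ 4) (2 `^ m).
clear; move=> r D D' K h P; by rewrite le_eqVlt; apply/orP; left; apply/eqP; ring.
Qed.

(** * Dyadic summation *)

(** Two sequences of radii, because a series indexed by [nat] runs in one direction
    only. *)
Definition dyadic_radius (R : realType) (large : bool) (i : nat) : R :=
  if large then 2 ^+ i else (1 / 2) ^+ i.+1.

(** A geometric bound for the decay weight on a shell: the bracket is at least the
    inner radius on the large shells and at least 1 on the small ones. *)
Definition dyadic_decay (R : realType) (m : R) (large : bool) (i : nat) : R :=
  if large then (2 `^ m)^-1 ^+ i else 1.

Definition dyadic_ratio (R : realType) (m : R) (large : bool) : R :=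
  if large then 16 / 2 `^ m else 1 / 2.

Lemma dyadic_radius_gt0 (R : realType) large i : 0 < dyadic_radius R large i.
Proof. by case: large; rewrite /dyadic_radius exprn_gt0// divr_gt0. Qed.

Lemma natr_le_expr2 (R : realType) (r : R) : 0 <= r -> exists i, r <= 2 ^+ i.+1.
Proof.
move=> r0; exists (Num.truncn r); have /andP[_ /ltW/le_trans] := truncn_itv r0; apply.
by rewrite -natrX ler_nat ltnW// ltn_expl.
Qed.

Lemma dyadic_radiusP (R : realType) (r : R) : 0 < r ->
  exists large i, dyadic_radius R large i <= r <= 2 * dyadic_radius R large i.
Proof.
move=> r0; have [r1|r1] := leP 1 r.
  have [j jP jmin] := ex_minnP (natr_le_expr2 (ltW r0)).
  exists true, j; rewrite /dyadic_radius -exprS jP andbT.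
  case: j {jP} jmin => [|j] jmin; first by rewrite expr0.
  by rewrite leNgt; apply/negP => /ltW/jmin; rewrite ltnn.
have [j0 j0P] := natr_le_expr2 (ltW (divr_gt0 ltr01 r0)).
have ex : exists j, (1 / 2) ^+ j.+1 <= r.
  exists j0; rewrite expr_div_n expr1n ler_pdivrMr ?exprn_gt0//.
  by move: j0P; rewrite ler_pdivrMr// mulrC.
have [j jP jmin] := ex_minnP ex.
exists false, j; rewrite /dyadic_radius jP/=.
case: j {jP} jmin => [|j] jmin; first by rewrite expr1; lra.
have -> : 2 * (1 / 2) ^+ j.+2 = (1 / 2) ^+ j.+1 :> R by rewrite [in LHS]exprS; field.
by rewrite leNgt; apply/negP => /ltW/jmin; rewrite ltnn.
Qed.

Lemma dyadic_decayP (R : realType) (m : R) large i (k : 'rV[R]_2) : 0 <= m ->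
  dyadic_radius R large i <= enorm k -> decay m k <= dyadic_decay m large i.
Proof.
move=> m0; rewrite /dyadic_radius /dyadic_decay; case: large => ik; last first.
  by apply: (le_trans (decay_le m0 ltr01 (bracket_ge1 k))); rewrite powR1 invr1.
have i0 : 0 < 2 ^+ i :> R by rewrite exprn_gt0.
apply: (le_trans (decay_le m0 i0 (le_trans ik (enorm_le_bracket k)))).
by rewrite exprVn -powR_mulrn// -powRrM mulrC powRrM powR_mulrn// powR_ge0.
Qed.

Lemma dyadic_ratio_itv (R : realType) (m : R) large : 4 < m ->
  0 <= dyadic_ratio m large < 1.
Proof.
move=> m4; rewrite /dyadic_ratio; case: large; last by apply/andP; split; lra.
have p0 : 0 < 2 `^ m :> R by rewrite powR_gt0.
rewrite divr_ge0 ?powR_ge0//= ltr_pdivrMr// mul1r.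
have -> : 16 = 2 `^ 4 :> R by rewrite powR_mulrn//; ring.
by rewrite /powR pnatr_eq0 /= ltr_expR ltr_pM2r ?ln_gt0 ?ltr1n.
Qed.

(** Three powers of the radius come from the integrand and one from the length of
    the shell.  On large shells the ratio is [2 ^ (4 - m)]. *)
Lemma dyadic_product_le (R : realType) (m : R) large i :
  dyadic_radius R large i ^+ 4 * dyadic_decay m large i <= dyadic_ratio m large ^+ i.
Proof.
rewrite /dyadic_radius /dyadic_decay /dyadic_ratio; case: large.
  rewrite exprAC -exprMn (_ : 2 ^+ 4 = 16)//; ring.
rewrite mulr1 -exprM.
have h0 : 0 <= 1 / 2 :> R by lra.
have h1 : 1 / 2 <= 1 :> R by lra.
by apply: ler_wiXn2l => //; lia.
Qed.

(** The four families of shells that cover the domain of integration are indexed by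
    the half that is the shorter one and by the sequence of radii. *)
Lemma collision_integral_le (R : realType) (eps m : R) : 0 < eps -> 4 < m ->
  exists2 C : R, 0 <= C & forall (chi : R -> R) (n : mode R -> R) (N : R) (a : mode R)
    (sb sg : bool), is_cutoff eps chi ->
  (forall b, 0 <= n b) -> (forall b, n b <= N * decay m b.2) -> a.2 != 0 ->
  (`|\int[@hausdorff1 R (2 + 2) : {measure set (borel_rV R (2 + 2)) -> \bar R}]_(p in
        resonant_set a sb sg `&` [set p | coarea_factor a sb sg p != 0%R])
      (collision_integrand chi n a (sb, lsubmx p) (sg, rsubmx p)
        / coarea_factor a sb sg p)%:E| <= (C * N ^+ 2 * decay m a.2)%:E)%E.
Proof.
move=> eps0 m4; have m0 : 0 <= m by lra.
have [K K0 shell] := hausdorff1_shell eps0.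
have q01 large := dyadic_ratio_itv large m4.
pose G large := (1 - dyadic_ratio m large)^-1.
have G0 large : 0 <= G large by rewrite invr_ge0 subr_ge0; have /andP[_ /ltW] := q01 large.
have [B B0 quotient] := collision_quotient_le eps0 m0.
have S0 : 0 <= \sum_(h : bool * bool) 8 * B * K * G h.2.
  by apply: sumr_ge0 => h _; rewrite !mulr_ge0.
exists (\sum_(h : bool * bool) 8 * B * K * G h.2) => //.
move=> chi n N a sb sg cutoff n0 nN an.
have chi01 : forall t, 0 <= chi t <= 1 by case: cutoff.
have da := decay_gt0 m a.2.
have [ca|ca] := eqVneq (chi (angle a.2)) 0.
  rewrite integral0_eq ?abse0 ?lee_fin.
    exact: mulr_ge0 (mulr_ge0 S0 (sqr_ge0 N)) (ltW da).
  by move=> p _; rewrite /collision_integrand ca mulr0 !mul0r.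
have [ea ea'] := cutoff_support cutoff an ca.
pose fst (h : bool) (p : 'rV[R]_(2 + 2)) := if h then lsubmx p else rsubmx p.
pose sfst (h : bool) := if h then sb else sg.
pose W := B * N ^+ 2 * decay m a.2.
have W0 : 0 <= W by exact: mulr_ge0 (mulr_ge0 B0 (sqr_ge0 N)) (ltW da).
pose E (h : bool * bool) i := resonant_shell eps a (sfst h.1) (sfst (~~ h.1))
  (fst h.1) (fst (~~ h.1)) (dyadic_radius R h.2 i).
pose c (h : bool * bool) i := W * (8 * dyadic_radius R h.2 i ^+ 3 * dyadic_decay m h.2 i).
have rad0 large i := ltW (dyadic_radius_gt0 R large i).
have dec0 large i : 0 <= dyadic_decay m large i.
  by rewrite /dyadic_decay; case: large; rewrite ?exprn_ge0 ?invr_ge0 ?powR_ge0.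
have c0 h i : 0 <= c h i.
  by apply: mulr_ge0 => //; apply: mulr_ge0 => //; apply: mulr_ge0 => //; exact: exprn_ge0.
have fst_cont h i : continuous (fun p => fst h p 0 i).
  have -> : (fun p => fst h p 0 i) =
      (fun p : 'rV[R]_(2 + 2) => p 0 (if h then lshift 2 i else rshift 2 i)).
    by apply/funext => p; case: h; rewrite mxE.
  exact: coord_continuous.
have fst_dist h p q : enorm (p - q) ^+ 2 =
    enorm (fst h p - fst h q) ^+ 2 + enorm (fst (~~ h) p - fst (~~ h) q) ^+ 2.
  suff split : enorm (p - q) ^+ 2 =
      enorm (lsubmx p - lsubmx q) ^+ 2 + enorm (rsubmx p - rsubmx q) ^+ 2.
    by case: h; rewrite /fst //= [RHS]addrC.
  rewrite {1}/enorm sqr_sqrtr ?sumr_ge0// => [|i _]; last exact: sqr_ge0.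
  by rewrite big_split_ord/= !sum_ord2 !enorm_sqr !mxE.
apply: (@le_trans _ _ (\sum_(h : bool * bool) \sum_(i <oo)
    (c h i)%:E * @hausdorff1 R (2 + 2) (E h i))%E).
  apply: abs_integral_le_cover => //.
  - by move=> h i; apply: measurable_resonant_shell => j; exact: fst_cont.
  - move=> p [[ln rn sum0 res] _] F0.
    have J_E := coarea_factorE a sb sg ln rn.
    set F := collision_integrand chi n a (sb, lsubmx p) (sg, rsubmx p) / _ in F0 *.
    have F0' : collision_integrand chi n a (sb, lsubmx p) (sg, rsubmx p) != 0.
      by apply: contra_neq F0 => I0; rewrite /F I0 mul0r.
    have cl : chi (angle (lsubmx p)) != 0.
      by apply: contra_neq F0' => c0'; rewrite /collision_integrand /= c0' mulr0 !mul0r.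
    have cr : chi (angle (rsubmx p)) != 0.
      by apply: contra_neq F0' => c0'; rewrite /collision_integrand /= c0' mulr0 !mul0r.
    have [h hmin] : exists h, enorm (fst h p) <= enorm (fst (~~ h) p).
      have [lr|/ltW rl] := leP (enorm (lsubmx p)) (enorm (rsubmx p)).
        by exists true.
      by exists false.
    have [xn yn sum0' res' [cx FE]] : [/\ fst h p != 0, fst (~~ h) p != 0,
        a.2 + fst h p + fst (~~ h) p = 0,
        omega a + omega (sfst h, fst h p) + omega (sfst (~~ h), fst (~~ h) p) = 0 &
        chi (angle (fst h p)) != 0 /\
        F = collision_integrand chi n a (sfst h, fst h p) (sfst (~~ h), fst (~~ h) p)
          / (Num.sqrt 2 * enorm (phase_grad (sfst h) (sfst (~~ h)) (fst h p) (fst (~~ h) p)))].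
      have FE : F = collision_integrand chi n a (sb, lsubmx p) (sg, rsubmx p)
          / (Num.sqrt 2 * enorm (phase_grad sb sg (lsubmx p) (rsubmx p))).
        by rewrite /F J_E.
      case: (h); first exact: And5 ln rn sum0 res (conj cl FE).
      have sum0s : a.2 + rsubmx p + lsubmx p = 0 by rewrite addrAC.
      have ress : omega a + omega (sg, rsubmx p) + omega (sb, lsubmx p) = 0.
        by rewrite addrAC.
      have FEs : F = collision_integrand chi n a (sg, rsubmx p) (sb, lsubmx p)
          / (Num.sqrt 2 * enorm (phase_grad sg sb (rsubmx p) (lsubmx p))).
        rewrite FE collision_integrandC -[enorm (phase_grad sg sb _ _)]enormN.
        by rewrite /phase_grad opprB.
      exact: And5 rn ln sum0s ress (conj cr FEs).
    have [ex _] := cutoff_support cutoff xn cx.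
    have [large [i ri]] := dyadic_radiusP (enorm_gt0 xn).
    exists (h, large), i; split.
      split => //; first exact/(resonance_clear a (sfst h) (sfst (~~ h)) xn yn).
      rewrite -ler_pdivlMr ?enorm_gt0//.
      by rewrite -[X in _ / X](gtr0_norm (enorm_gt0 xn)) -normf_div.
    rewrite lee_fin FE.
    apply: (le_trans (quotient N _ _ _ _ _ _ _ chi01 n0 nN an xn yn sum0' res' ea ea' ex hmin)).
    rewrite /c /= -/W ler_wpM2l// mulrC; case/andP: ri => ri1 ri2.
    apply: ler_pM; [by rewrite exprn_ge0// enorm_ge0|exact: ltW (decay_gt0 _ _)| |].
      have -> : 8 * dyadic_radius R large i ^+ 3 = (2 * dyadic_radius R large i) ^+ 3 by ring.
      by rewrite ler_pXn2r ?nnegrE ?enorm_ge0// mulr_ge0.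
    exact: dyadic_decayP.
have -> : (\sum_(h : bool * bool) 8 * B * K * G h.2) * N ^+ 2 * decay m a.2 =
    \sum_(h : bool * bool) 8 * W * K * G h.2.
  by rewrite !mulr_suml; apply: eq_bigr => h _; rewrite /W; ring.
rewrite -sumEFin; apply: lee_sum => h _.
have WK0 : 0 <= 8 * W * K by exact: mulr_ge0 (mulr_ge0 (ler0n _ 8) W0) K0.
apply: nneseries_geometric_le => //.
move=> i; apply/andP; split; first by rewrite mule_ge0 ?lee_fin// ?c0.
apply: (@le_trans _ _ ((c h i)%:E * (K * dyadic_radius R h.2 i)%:E)%E).
  apply: lee_wpmul2l; first by rewrite lee_fin.
  by apply: shell => //; exact: dyadic_radius_gt0.
rewrite -EFinM lee_fin.
have -> : c h i * (K * dyadic_radius R h.2 i) =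
    8 * W * K * (dyadic_radius R h.2 i ^+ 4 * dyadic_decay m h.2 i) by rewrite /c; ring.
by rewrite ler_wpM2l// dyadic_product_le.
Qed.

Lemma collision_le (R : realType) (eps m : R) : 0 < eps -> 4 < m ->
  exists2 C : R, 0 <= C & forall (chi : R -> R) (n : mode R -> R) (N : R) (a : mode R),
  is_cutoff eps chi ->
  (forall b, 0 <= n b) -> (forall b, n b <= N * decay m b.2) ->
  (`|collision chi n a| <= (C * N ^+ 2 * decay m a.2)%:E)%E.
Proof.
move=> eps0 m4; have [C C0 int_le] := collision_integral_le eps0 m4.
exists (4 * C) => [|chi n N a cutoff n0 nN]; first by rewrite mulr_ge0.
have [a0|an] := eqVneq a.2 0.
  rewrite /collision a0 eqxx abse0 lee_fin.
  exact: mulr_ge0 (mulr_ge0 (mulr_ge0 _ C0) (sqr_ge0 N)) (ltW (decay_gt0 m _)).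
have -> : 4 * C * N ^+ 2 * decay m a.2 =
    \sum_(sb : bool) \sum_(sg : bool) C * N ^+ 2 * decay m a.2.
  by rewrite !big_bool /=; ring.
rewrite /collision (negPf an) -sumEFin; apply: (le_trans (lee_abs_sum _ _ _)).
apply: lee_sum => sb _; rewrite -sumEFin; apply: (le_trans (lee_abs_sum _ _ _)).
by apply: lee_sum => sg _; exact: int_le.
Qed.

Lemma Linf_decay (R : realType) (m : R) (n : mode R -> R) : Linf m n ->
  exists2 N : R, Linf_norm m (EFin \o n) = N%:E & forall a, n a <= N * decay m a.2.
Proof.
move=> [n0 _ nfin].
have le_norm a : ((bracket a.2 `^ m * n a)%:E <= Linf_norm m (EFin \o n))%E.
  apply: ereal_sup_ubound; exists a => //.
  by rewrite /= -EFinM; congr (_%:E); rewrite ger0_norm.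
have fin : Linf_norm m (EFin \o n) \is a fin_num.
  rewrite ge0_fin_numE//; apply: le_trans (le_norm (false, 0)).
  by rewrite lee_fin mulr_ge0// powR_ge0.
exists (fine (Linf_norm m (EFin \o n))) => [|a]; first by rewrite fineK.
have p0 : 0 < bracket a.2 `^ m by rewrite powR_gt0// bracket_gt0.
rewrite /decay ler_pdivlMr// mulrC -lee_fin fineK//.
Qed.

Lemma Linf_norm_le (R : realType) (m A : R) (f : mode R -> \bar R) :
  (forall a, (`|f a| <= (A * decay m a.2)%:E)%E) -> (Linf_norm m f <= A%:E)%E.
Proof.
move=> fA; apply: ge_ereal_sup => _ [a _ <-].
have p0 : 0 < bracket a.2 `^ m by rewrite powR_gt0// bracket_gt0.
apply: (@le_trans _ _ ((bracket a.2 `^ m)%:E * (A * decay m a.2)%:E)%E).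
  by apply: lee_wpmul2l; [rewrite lee_fin ltW|exact: fA].
by rewrite -EFinM lee_fin /decay mulrCA mulfV ?mulr1// gt_eqF.
Qed.

Theorem theorem1p2 (R : realType) :
  exists2 eps0 : R, 0 < eps0 &
  forall (eps : R) (chi : R -> R), 0 < eps < eps0 -> is_cutoff eps chi ->
  forall m : R, 4 < m ->
  (exists C : R, forall n : mode R -> R, Linf m n ->
     (Linf_norm m (collision chi n) <= C%:E * Linf_norm m (EFin \o n) ^+ 2)%E) /\
  (forall n : mode R -> R, Linf m n ->
     (forall a : mode R, collision chi n a \is a fin_num) /\
     (Linf_norm m (collision chi n) < +oo)%E).
Proof.
(* The estimates hold for every positive eps, with constants that degenerate as
   eps tends to 0; the threshold 1 is arbitrary. *)
exists 1 => // eps chi /andP[eps0 _] cutoff m m4.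
have [C _ coll_le] := collision_le eps0 m4.
have bound n : Linf m n ->
    exists2 N : R, Linf_norm m (EFin \o n) = N%:E &
      forall a, (`|collision chi n a| <= (C * N ^+ 2 * decay m a.2)%:E)%E.
  move=> nL; have [N NE nN] := Linf_decay nL; exists N => // a.
  by apply: coll_le => //; case: nL.
split.
  exists C => n /bound[N NE /Linf_norm_le normC].
  by rewrite NE -EFin_expe -EFinM.
move=> n /bound[N NE collN]; split => [a|].
  by rewrite fin_num_abs (le_lt_trans (collN a))// ltry.
by rewrite (le_lt_trans (Linf_norm_le collN))// ltry.
Qed.
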